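(* Assume that condition $\mathcal S^{(1)}(r_n,u_n)$ holds. For any bounded $H\in\mathcal H$, $$\lim_{n\to\infty}\frac{E[H(u_n^{-1}X_{1,2r_n})1\{A_1\cap A_2\}]}{w_n}=\vartheta\,E[(\mathcal L(Z)-1)H(Z)].$$
   Context: Fix $d\ge1$, a norm $|\cdot|$ on $\mathbb R^d$, and a stationary regularly varying $\mathbb R^d$-valued time series $X=(X_j)_{j\in\mathbb Z}$ with tail index $\alpha>0$: there is a process $Y=(Y_j)_{j\in\mathbb Z}$ (the tail process) such that for all $i\le j$ the law of $x^{-1}(X_i,\dots,X_j)$ given $|X_0|>x$ converges weakly to the law of $(Y_i,\dots,Y_j)$ as $x\to\infty$. $u_n>0$, $r_n\in\mathbb N$, $w_n=P(|X_0|>u_n)$, with $u_n,r_n,nw_n\to\infty$, $r_n/n\to0$, $r_nw_n\to0$. $\ell_0$: sequences $x=(x_j)_{j\in\mathbb Z}$ in $\mathbb R^d$ tending to zero as $|j|\to\infty$, with the supremum norm. $x_{i,j}=(x_i,\dots,x_j)$, $x^*_{i,j}=\max_{i\le l\le j}|x_l|$, $x^*=\sup_j|x_j|$. Finite vectors are identified with elements of $\ell_0$ by zero padding, and functionals applied to them are shift-invariant. $T_{\min}(x)=\inf\{j:|x_j|>1\}$, $T_{\max}(x)=\sup\{j:|x_j|>1\}$; cluster length $\mathcal L(x)=T_{\max}(x)-T_{\min}(x)+1$, with $\mathcal L(x)=0$ if $x^*\le1$. $\mathcal H$: the class of (shift-invariant) $H:\ell_0\to[0,\infty)$, almost surely continuous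 with respect to the law of $Y$, with $H(x)=0$ if $x^*\le1$ and $H(x)=H(x_{T_{\min}(x),T_{\max}(x)})$ otherwise. $A_j=\{X^*_{(j-1)r_n+1,jr_n}>u_n\}$. $\vartheta=P(Y^*_{-\infty,-1}\le1)$, and $Z$ has the law of $Y$ conditioned on $Y^*_{-\infty,-1}\le1$. Condition $\mathcal S^{(\kappa)}(r_n,u_n)$: for all $s,t>0$, $\lim_{\ell\to\infty}\limsup_{n\to\infty}\frac1{w_n}\sum_{i=\ell}^{r_n}i^\kappa P(|X_0|>u_ns,|X_i|>u_nt)=0$; by convention it is understood to hold also with $r_n$ replaced by $cr_n$ for constants $c>1$. (It implies $Y\in\ell_0$ a.s. and $\vartheta>0$.) *)

(* Defs.v *)
From HB Require Import structures.
From mathcomp Require Import all_boot all_order all_algebra.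
From mathcomp Require Import all_classical all_reals all_analysis.

Set Implicit Arguments.
Unset Strict Implicit.
Unset Printing Implicit Defensive.

Import Order.TTheory GRing.Theory Num.Theory.
Import numFieldNormedType.Exports.

Local Open Scope classical_set_scope.
Local Open Scope ring_scope.

Section sequences.
Context {R : realType} {d : nat}.

Record is_norm (N : 'rV[R]_d -> R) : Prop := IsNorm {
  norm_ge0 : forall v, 0 <= N v ;
  norm_eq0 : forall v, N v = 0 -> v = 0 ;
  norm_scale : forall (a : R) v, N (a *: v) = `|a| * N v ;
  norm_triangle : forall v w, N (v + w) <= N v + N w }.

Definition coordinate_events : set (set (int -> 'rV[R]_d)) :=
  [set C | exists (j : int) (U : set 'rV[R]_d),
     open U /\ C = [set x | U (x j)]].

(* (R^d)^Z with its product sigma-algebra. A process indexed by Z is a single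
   random element of this space. Since ell_0 is separable for the supremum
   norm, its Borel sigma-algebra is the trace of this one. *)
Definition pathspace := g_sigma_algebraType coordinate_events.

Definition shift_path (k : int) (x : pathspace) : pathspace :=
  fun j => x (j + k).

Definition int_segment (a b : int) : set int := [set j | a <= j <= b].

Definition restrict_path (A : set int) (x : pathspace) : pathspace :=
  patch (cst 0) A x.

Definition scale_path (a : R) (x : pathspace) : pathspace := fun j => a *: x j.

(* The matrix with rows x_i, ..., x_(i+m). *)
Definition window (i : int) (m : nat) (x : pathspace) : 'M[R]_(m.+1, d) :=
  \matrix_(k < m.+1, l < d) x (i + (k : nat)%:Z) 0 l.

Variable N : 'rV[R]_d -> R.

Definition ell0 : set pathspace :=
  [set x | forall e : R, 0 < e ->
     exists m : nat, forall j : int, (m <= `|j|)%N -> N (x j) < e].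

(* sup_(j in A) |x_j|; it may be +oo, and is -oo when A is empty. *)
Definition star (A : set int) (x : pathspace) : \bar R :=
  ereal_sup [set (N (x j))%:E | j in A].

(* Infimum and supremum are taken in the extended line; on ell_0 both are
   integers as soon as x^* > 1. *)
Definition Tmin (x : pathspace) : \bar R :=
  ereal_inf [set (j%:~R : R)%:E | j in [set j : int | 1 < N (x j)]].

Definition Tmax (x : pathspace) : \bar R :=
  ereal_sup [set (j%:~R : R)%:E | j in [set j : int | 1 < N (x j)]].

Definition cluster_length (x : pathspace) : R :=
  if (star setT x <= 1)%E then 0 else fine (Tmax x - Tmin x + 1)%E.

Definition cluster_part (x : pathspace) : pathspace :=
  restrict_path
    [set j : int | (Tmin x <= (j%:~R : R)%:E <= Tmax x)%E] x.

Definition ell0_continuous_at (H : pathspace -> R) (x : pathspace) : Prop :=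
  forall e : R, 0 < e -> exists2 del : R, 0 < del &
    forall y : pathspace, ell0 y ->
      (star setT (fun j => (y j - x j)%R) < del%:E)%E -> `|H y - H x| < e.

(* H is a functional on ell_0: its values outside ell_0 are irrelevant. *)
Record cluster_functional dY (T : measurableType dY) (Q : probability T R)
    (Y : {RV Q >-> pathspace}) (H : pathspace -> R) : Prop := ClusterFunctional {
  cf_measurable : measurable_fun ell0 H ;
  cf_ge0 : forall x, ell0 x -> 0 <= H x ;
  cf_shift : forall k x, ell0 x -> H (shift_path k x) = H x ;
  cf_continuous : {ae Q, forall w, ell0 (Y w) -> ell0_continuous_at H (Y w)} ;
  cf_small : forall x, ell0 x -> (star setT x <= 1)%E -> H x = 0 ;
  cf_cluster : forall x, ell0 x -> (1 < star setT x)%E ->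
    H x = H (cluster_part x) }.

End sequences.

Arguments pathspace : clear implicits.

Section time_series.
Context {R : realType} {d : nat} (N : 'rV[R]_d -> R).
Context {dX : measure_display} {Omega : measurableType dX}
  {P : probability Omega R} (X : {RV P >-> pathspace R d}).

Definition prob (A : set Omega) : R := fine (P A).

Definition stationary : Prop :=
  forall (k : int) (A : set (pathspace R d)), measurable A ->
    P [set w | A (shift_path k (X w))] = P [set w | A (X w)].

Definition exceedance (x : R) : set Omega := [set w | x < N (X w 0)].

Definition tail_index (alpha : R) : Prop :=
  forall t : R, 0 < t ->
    prob (exceedance (t * x)) / prob (exceedance x) @[x --> +oo]
      --> t `^ (- alpha).

(* Weak convergence is tested against bounded continuous functions of
   (x_i, ..., x_(i+m)). *)
Definition tail_process dY (T : measurableType dY) (Q : probability T R)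
    (Y : {RV Q >-> pathspace R d}) : Prop :=
  forall (i : int) (m : nat) (f : 'M[R]_(m.+1, d) -> R),
    continuous f -> (exists M : R, forall v, `|f v| <= M) ->
    fine 'E_P[fun w => f (window i m (scale_path x^-1 (X w)))
                       * \1_(exceedance x) w] / prob (exceedance x)
      @[x --> +oo] --> fine 'E_Q[fun w => f (window i m (Y w))].

(* The sum runs over i = l, ..., r_n. *)
Definition anticlustering (kappa : R) (r : nat -> nat) (u : nat -> R) : Prop :=
  forall s t : R, 0 < s -> 0 < t ->
    limn_esup (fun n =>
      ((prob (exceedance (u n)))^-1 *
       \sum_(l <= i < (r n).+1) (i%:R `^ kappa *
          prob [set w | u n * s < N (X w 0) /\ u n * t < N (X w i%:Z)]))%:E)
      @[l --> \oo] --> 0%E.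

(* The condition for r_n is understood to include the one for every multiple
   c r_n, c > 1, rounded down. *)
Definition condition_S (kappa : R) (r : nat -> nat) (u : nat -> R) : Prop :=
  anticlustering kappa r u /\
  forall c : R, 1 < c ->
    anticlustering kappa (fun n => Num.truncn (c * (r n)%:R)) u.

Definition block_event (r : nat) (u : R) (j : nat) : set Omega :=
  [set w | (u%:E < star N (int_segment (j.-1 * r).+1%:Z (j * r)%N%:Z) (X w))%E].

End time_series.

Section conditioned_tail_process.
Context {R : realType} {d : nat} (N : 'rV[R]_d -> R).
Context {dY : measure_display} {T : measurableType dY}
  {Q : probability T R} (Y : {RV Q >-> pathspace R d}).

Definition no_past_exceedance : set T :=
  [set w | (star N [set j : int | (j <= -1)%R] (Y w) <= 1)%E].

Definition candidate_extremal_index : R := prob (P := Q) no_past_exceedance.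

Definition conditioned_law dZ (S : measurableType dZ) (Q' : probability S R)
    (Z : {RV Q' >-> pathspace R d}) : Prop :=
  forall A : set (pathspace R d), measurable A ->
    prob (P := Q') [set w | A (Z w)] =
    prob (P := Q) [set w | A (Y w) /\ no_past_exceedance w]
      / candidate_extremal_index.

End conditioned_tail_process.

(* Main.v *)
(** Split H(x) 1_{A_1 /\ A_2} according to the position r - k of the first
    exceedance: given that position, a second block exceedance means that two
    exceedances are more than k apart. Moving the first exceedance to the origin
    by stationarity, the expectation is the sum over k < r of the mean of
      Phi_k(x) = H(x) 1{|x_0| > 1, no earlier exceedance,
                        two exceedances more than k apart}
    evaluated at X / u_n restricted to [1 - r + k, r + k]. For fixed k,
    anticlustering allows replacing that window by [-m, m], on which weak
    convergence to Y applies through Lipschitz envelopes of Phi_k. Since at most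
    i values of k are compatible with an exceedance at distance i, the tail of
    the sum is at most (sup H) sum_i i P(|X_0| > u_n, |X_i| > u_n) / w_n, which is
    exactly what S^(1) controls. Finally sum_k 1{spread > k} = L - 1. *)
Require Import Defs.
From HB Require Import structures.
From mathcomp Require Import all_boot all_order all_algebra.
From mathcomp Require Import all_classical all_reals all_analysis measurable_realfun.
From mathcomp Require Import lra zify.

Set Implicit Arguments.
Unset Strict Implicit.
Unset Printing Implicit Defensive.

Import Order.TTheory GRing.Theory Num.Theory.
Import numFieldNormedType.Exports.

Local Open Scope classical_set_scope.
Local Open Scope ring_scope.

(** * Norms and measurability on path space *)

Section norm_on_rows.
Context {R : realType} {d : nat} (N : 'rV[R]_d -> R) (hN : is_norm N).

Lemma is_norm0 : N 0 = 0.
Proof. by rewrite -(scale0r (0 : 'rV[R]_d)) (norm_scale hN) normr0 mul0r. Qed.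

Lemma is_normN v : N (- v) = N v.
Proof. by rewrite -scaleN1r (norm_scale hN) normrN normr1 mul1r. Qed.

Lemma is_norm_sum (I : Type) (s : seq I) (F : I -> 'rV[R]_d) :
  N (\sum_(i <- s) F i) <= \sum_(i <- s) N (F i).
Proof.
elim: s => [|i s IH]; first by rewrite !big_nil is_norm0.
by rewrite !big_cons (le_trans (norm_triangle hN _ _))// lerD2l.
Qed.

Lemma is_norm_le v :
  N v <= (\sum_(j < d) N (delta_mx 0 j)) * `|v|.
Proof.
rewrite [in leLHS](row_sum_delta v) (le_trans (is_norm_sum _ _))//.
rewrite mulr_suml ler_sum// => j _.
rewrite (norm_scale hN) mulrC ler_wpM2l ?(norm_ge0 hN)//.
rewrite [leRHS]mx_normE -[leLHS]nngE num_le.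
exact: (le_bigmax 0%:nng (fun i : 'I_1 * 'I_d => `|v i.1 i.2|%:nng) (0, j)).
Qed.

Lemma is_norm_dist v w : `|N v - N w| <= N (v - w).
Proof.
rewrite ler_norml; apply/andP; split; last first.
  by rewrite lerBlDr -{1}(subrK w v) (norm_triangle hN).
rewrite lerNl opprB lerBlDr -{1}(subrK v w).
by rewrite -(is_normN (v - w)) opprB (norm_triangle hN).
Qed.

Lemma is_norm_small (e : R) : 0 < e -> exists2 del : R, 0 < del &
  forall v, `|v| < del -> N v < e.
Proof.
move=> e0; set C := \sum_(j < d) N (delta_mx 0 j).
have C0 : 0 <= C by apply: sumr_ge0 => j _; exact: norm_ge0.
exists (e / (C + 1)) => [|v]; first by rewrite divr_gt0// ltr_wpDl.
rewrite ltr_pdivlMr ?ltr_wpDl// => hv; apply: le_lt_trans hv.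
by rewrite (le_trans (is_norm_le v))// mulrC ler_wpM2l// lerDl.
Qed.

Lemma is_norm_continuous : continuous (N : 'rV[R]_d -> R).
Proof.
move=> v; apply/(@cvgrPdist_lt _ _ _ (nbhs v)) => e e0.
have [del del0 hdel] := is_norm_small e0.
have : nbhs v (ball (v : 'rV[R]_d) del) by exact: nbhsx_ballx.
apply: filterS => w; rewrite -ball_normE/= => hw.
by rewrite (le_lt_trans (is_norm_dist v w))// hdel.
Qed.

End norm_on_rows.

Section path_measurability.
Context {R : realType} {d : nat}.
Notation path := (pathspace R d).

Lemma measurable_coordinate_preimage (j : int) (U : set 'rV[R]_d) :
  open U -> measurable ([set x | U (x j)] : set path).
Proof. by move=> oU; apply: sub_sigma_algebra; exists j, U. Qed.

Lemma measurable_fun_path d' (T : measurableType d') (f : T -> path) :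
  (forall j U, open U -> measurable [set w | U (f w j)]) ->
  measurable_fun setT f.
Proof.
move=> hf; refine (@measurability _ _ T path setT f (@coordinate_events R d) erefl _).
move=> _ [_ [j [U [oU ->]]] <-]; rewrite setTI; exact: hf.
Qed.

Lemma measurable_shift_path k : measurable_fun setT (@shift_path R d k).
Proof.
apply: measurable_fun_path => j U oU.
exact: (measurable_coordinate_preimage (j + k)).
Qed.

Lemma measurable_scale_path a : measurable_fun setT (@scale_path R d a).
Proof.
apply: measurable_fun_path => j U oU.
apply: (@measurable_coordinate_preimage j ( *:%R a @^-1` U)).
by apply: open_comp => // x _; exact: scaler_continuous.
Qed.

Lemma measurable_restrict_path A : measurable_fun setT (@restrict_path R d A).
Proof.
apply: measurable_fun_path => j U oU; rewrite /restrict_path /patch.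
case: (j \in A); first exact: measurable_coordinate_preimage.
by have [U0|U0] := pselect (U 0);
  [rewrite (_ : mkset _ = setT)//|rewrite (_ : mkset _ = set0)//];
  apply/seteqP; split.
Qed.

Lemma measurable_fun_preimage_open d' (T : measurableType d') (f : T -> R) :
  (forall U, open U -> measurable (f @^-1` U)) -> measurable_fun setT f.
Proof.
move=> hf; apply: (measurability _ (RGenOpens.measurableE R)) => //.
move=> _ [_ [a [b ->]] <-]; rewrite setTI; apply: hf; exact: interval_open.
Qed.

Lemma measurable_coordinate_comp (j : int) (f : 'rV[R]_d -> R) :
  continuous f -> measurable_fun setT (fun x : path => f (x j)).
Proof.
move=> /continuousP cf; apply: measurable_fun_preimage_open => U oU.
by apply: (@measurable_coordinate_preimage j (f @^-1` U)); exact: cf.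
Qed.

Lemma measurable_window i m (U : set 'M[R]_(m.+1, d)) :
  open U -> measurable ([set x | U (window i m x)] : set path).
Proof.
move=> oU.
pose box (q : 'M[rat]_(m.+1, d)) (p : nat) : set 'M[R]_(m.+1, d) :=
  [set v | forall k l, `|ratr (q k l) - v k l| < p.+1%:R^-1].
rewrite (_ : mkset _ = \bigcup_(qp in [set qp | box qp.1 qp.2 `<=` U])
    [set x : path | box qp.1 qp.2 (window i m x)]); last first.
  apply/seteqP; split=> [x /= Ux|x /= [qp hqp]]; last exact: hqp.
  have /nbhs_ballP[e /= e0 he] : nbhs (window i m x) U by exact: open_nbhs_nbhs.
  have [p hp] : exists p : nat, p.+1%:R^-1 < e / 2.
    exists (Num.truncn (e / 2)^-1).
    rewrite invf_plt ?posrE ?divr_gt0//.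
    by rewrite truncnS_gt.
  have hq (k : 'I_m.+1) (l : 'I_d) :
      exists q : rat, `|ratr q - window i m x k l| < p.+1%:R^-1.
    have [q] := @rat_in_itvoo R (window i m x k l - p.+1%:R^-1)
                 (window i m x k l + p.+1%:R^-1) ltac:(by rewrite ltrBlDr -addrA ltrDl addr_gt0).
    rewrite in_itv/= => /andP[h1 h2]; exists q.
    by rewrite ltr_distl h1 h2.
  pose q : 'M[rat]_(m.+1, d) := \matrix_(k, l) projT1 (cid (hq k l)).
  have hqE k l : `|ratr (q k l) - window i m x k l| < p.+1%:R^-1.
    by rewrite mxE; case: cid.
  exists (q, p) => //= v hv; apply: he; split => // k l.
  rewrite /ball/= -(subrKA (ratr (q k l))) (le_lt_trans (ler_normD _ _))//.
  rewrite (splitr e) ltrD//; apply: lt_trans hp; last exact: hv.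
  by rewrite distrC; exact: hqE.
rewrite bigcup_mkcond; apply: countable_bigcupT_measurable => // -[q p].
case: ifP => // _; rewrite (_ : mkset _ = \bigcap_(k in [set: 'I_m.+1])
    \bigcap_(l in [set: 'I_d])
      [set x : path | `|ratr (q k l) - x (i + (k : nat)%:Z) 0 l| < p.+1%:R^-1]).
  apply: fin_bigcap_measurable => // k _; apply: fin_bigcap_measurable => // l _.
  apply: (@measurable_coordinate_preimage (i + (k : nat)%:Z)
    ((fun v : 'rV[R]_d => v 0 l) @^-1` ball (ratr (q k l) : R) p.+1%:R^-1)).
  apply: (@open_comp _ _ (fun v : 'rV[R]_d => v 0 l)); last exact: ball_open.
  by move=> v _; exact: coord_continuous.
by apply/seteqP; split=> x /= h k; [move=> _ l _|move=> l];
  have := h k; rewrite /window ?mxE => h'; [have := h' l; rewrite mxE|apply: h'].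
Qed.

Lemma measurable_window_comp i m (f : 'M[R]_(m.+1, d) -> R) :
  continuous f -> measurable_fun setT (fun x : path => f (window i m x)).
Proof.
move=> /continuousP cf; apply: measurable_fun_preimage_open => U oU.
by apply: (@measurable_window i m (f @^-1` U)); exact: cf.
Qed.

End path_measurability.

(** * Exceedances and anchored functionals *)

Section anchored_functionals.
Context {R : realType} {d : nat} (N : 'rV[R]_d -> R) (hN : is_norm N).
Notation path := (pathspace R d).

Lemma star_le (A : set int) (x : path) (c : R) :
  (star N A x <= c%:E)%E <-> forall j, A j -> N (x j) <= c.
Proof.
split=> [h j Aj|h].
  by rewrite -lee_fin (le_trans _ h)//; apply: ereal_sup_ubound; exists j.
by apply: ge_ereal_sup => _ [j Aj <-]; rewrite lee_fin h.
Qed.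

Lemma star_gt (A : set int) (x : path) (c : R) :
  (c%:E < star N A x)%E <-> exists2 j, A j & c < N (x j).
Proof.
split=> [|[j Aj cj]]; last first.
  by apply: (@lt_le_trans _ _ (N (x j))%:E) => //; apply: ereal_sup_ubound; exists j.
move=> h; apply: contrapT => /forall2NP hj.
move: h; apply/negP; rewrite -leNgt; apply/star_le => j Aj.
by rewrite leNgt; apply/negP; have [|] := hj j.
Qed.

Definition spread (k : nat) : set path :=
  [set x | exists i j : int, [/\ i + k.+1%:Z <= j, 1 < N (x i) & 1 < N (x j)]].

Definition anchored : set path :=
  [set x | 1 < N (x 0) /\ forall j : int, j < 0 -> N (x j) <= 1].

Definition exceedances_in (a b : int) : set path :=
  [set x | forall j, 1 < N (x j) -> int_segment a b j].

Lemma spread_ext k (x y : path) :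
  (forall j, (1 < N (x j)) = (1 < N (y j))) -> spread k x -> spread k y.
Proof. by move=> h [i [j [ij xi xj]]]; exists i, j; rewrite -!h. Qed.

Lemma anchored_ext (x y : path) :
  (forall j, (1 < N (x j)) = (1 < N (y j))) -> anchored x -> anchored y.
Proof.
by move=> h [x0 xj]; split=> [|j /xj]; rewrite -?h// !leNgt h.
Qed.

Lemma spread_shift k n (x : path) : spread k (shift_path n x) <-> spread k x.
Proof.
split=> -[i [j [ij xi xj]]].
  by exists (i + n), (j + n); split => //; rewrite addrAC lerD2r.
by exists (i - n), (j - n); split; rewrite /shift_path ?subrK// addrAC lerD2r.
Qed.

Lemma ell0_shift n (x : path) : ell0 N x -> ell0 N (shift_path n x).
Proof.
move=> hx e e0; have [m hm] := hx e e0.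
by exists (m + `|n|)%N => j hj; apply: hm; lia.
Qed.

Lemma ell0_eq_outside a b (x y : path) :
  (forall j, ~ int_segment a b j -> x j = y j) -> ell0 N x -> ell0 N y.
Proof.
move=> xy hx e e0; have [m hm] := hx e e0.
exists (m + `|a| + `|b| + 1)%N => j hj.
by rewrite -xy /int_segment/= ?hm//; lia.
Qed.

Lemma ell0_restrict_segment a b (x : path) :
  ell0 N (restrict_path (int_segment a b) x).
Proof.
apply: (@ell0_eq_outside a b (cst 0)).
  by move=> j hj; rewrite /restrict_path /patch ifF//; apply/negbTE/negP; rewrite inE.
by move=> e e0; exists 0 => j _; rewrite /= is_norm0.
Qed.

Lemma ell0_exceedance_bounds (x : path) j0 : ell0 N x -> 1 < N (x j0) ->
  exists a b, [/\ 1 < N (x a), 1 < N (x b) & exceedances_in a b x].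
Proof.
move=> hx xj0; have [m hm] := hx 1 ltr01.
have bd j : 1 < N (x j) -> (`|j| < m)%N.
  by move=> xj; rewrite ltnNge; apply/negP => /hm; rewrite ltNge (ltW xj).
pose pr (n : nat) := 1 < N (x (n%:Z - m%:Z)).
have exP : exists n, pr n.
  by exists (absz (j0 + m%:Z)); rewrite /pr (_ : _ - _ = j0)//; have := bd _ xj0; lia.
have ubP n : pr n -> (n <= m + m)%N by move=> /bd; lia.
exists ((ex_minn exP)%:Z - m%:Z), ((ex_maxn exP ubP)%:Z - m%:Z).
case: ex_minnP => a pa ha; case: ex_maxnP => b pb hb; split => // j xj.
have prj : pr (absz (j + m%:Z)).
  by rewrite /pr (_ : _ - _ = j)//; have := bd _ xj; lia.
rewrite /int_segment/=; have := ha _ prj; have := hb _ prj; have := bd _ xj; lia.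
Qed.

Lemma Tmin_ge a b (x : path) : exceedances_in a b x -> (a%:~R%:E <= Tmin N x)%E.
Proof.
move=> h; apply: le_ereal_inf_tmp => _ [j /h + <-].
by rewrite /int_segment/= lee_fin ler_int => /andP[].
Qed.

Lemma Tmax_le a b (x : path) : exceedances_in a b x -> (Tmax N x <= b%:~R%:E)%E.
Proof.
move=> h; apply: ge_ereal_sup => _ [j /h + <-].
by rewrite /int_segment/= lee_fin ler_int => /andP[].
Qed.

Lemma cluster_part_eq a b (x y : path) :
  (forall j, (1 < N (x j)) = (1 < N (y j))) ->
  exceedances_in a b x -> (forall j, int_segment a b j -> x j = y j) ->
  cluster_part N x = cluster_part N y.
Proof.
move=> hxy hx exy.
have e : [set j : int | 1 < N (x j)] = [set j : int | 1 < N (y j)].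
  by apply/seteqP; split=> j /=; rewrite hxy.
apply/funext => j; rewrite /cluster_part /restrict_path /patch /Tmin /Tmax e.
case: ifPn => //; rewrite inE/= -e => /andP[h1 h2]; apply: exy.
have := le_trans (Tmin_ge hx) h1; have := le_trans h2 (Tmax_le hx).
by rewrite /int_segment/= !lee_fin !ler_int => -> ->.
Qed.

Lemma cluster_length_eq a b (x : path) : 1 < N (x a) -> 1 < N (x b) ->
  exceedances_in a b x -> cluster_length N x = (b - a)%:~R + 1.
Proof.
move=> xa xb hx; rewrite /cluster_length ifF; last first.
  by apply/negbTE; rewrite -ltNge; apply/star_gt; exists a.
have -> : Tmin N x = a%:~R%:E.
  apply/eqP; rewrite eq_le (Tmin_ge hx) andbT.
  by apply: ereal_inf_lbound; exists a.
have -> : Tmax N x = b%:~R%:E.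
  apply/eqP; rewrite eq_le (Tmax_le hx)//=.
  by apply: ereal_sup_ubound; exists b.
by rewrite intrB.
Qed.

Lemma exceedances_stable (y : path) : ell0 N y -> (forall j, N (y j) != 1) ->
  exists2 del : R, 0 < del & forall z : path, (forall j, N (z j - y j) < del) ->
    forall j, (1 < N (z j)) = (1 < N (y j)).
Proof.
move=> hy y1; have [m hm] := hy 2^-1 ltac:(by rewrite invr_gt0).
have [del del0 hdel] : exists2 del : R, 0 < del &
    forall j : int, (`|j| < m)%N -> del <= `|N (y j) - 1|.
  elim: (m) => [|p [del del0 hdel]]; first by exists 1.
  exists (Num.min del (Num.min `|N (y p%:Z) - 1| `|N (y (- p%:Z)) - 1|)).
    by rewrite !lt_min del0 !normr_gt0 !subr_eq0 !y1.
  move=> j jp; rewrite !ge_min.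
  have [/hdel -> //|pj] := ltnP `|j| p.
  have [->|->] : j = p%:Z \/ j = - p%:Z by lia.
    by rewrite lexx orbT.
  by rewrite lexx !orbT.
exists (Num.min del 2^-1) => [|z hz j]; first by rewrite lt_min del0 invr_gt0/=.
have := le_lt_trans (is_norm_dist hN _ _) (hz j); rewrite lt_min => /andP[h1 h2].
have [/hdel h3|/hm h3] := ltnP `|j| m.
- move: h1 h3; rewrite ltr_norml => /andP[h4 h5] h6.
  have [yj|yj] := ltP 1 (N (y j)).
    by move: h6; rewrite ger0_norm ?subr_ge0 ?(ltW yj)// => ?; apply/idP; lra.
  by move: h6; rewrite ler0_norm ?subr_le0// => ?; apply/negbTE; rewrite -leNgt; lra.
- move: h2; rewrite ltr_norml => /andP[h4 h5].
  have -> : (1 < N (y j)) = false by apply/negbTE; rewrite -leNgt; lra.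
  by apply/negbTE; rewrite -leNgt; lra.
Qed.

Definition pad (m : nat) (v : 'M[R]_((2 * m).+1, d)) : path :=
  fun j => if - m%:Z <= j <= m%:Z then row (inord (absz (j + m%:Z))) v else 0.

Lemma pad_window m (x : path) :
  pad (window (- m%:Z) (2 * m) x) =
  restrict_path (int_segment (- m%:Z) m%:Z) x.
Proof.
apply/funext => j; rewrite /pad /restrict_path /patch; have [h|h] := boolP (_ <= _ <= _).
  rewrite ifT; last by rewrite inE.
  apply/rowP => l; rewrite !mxE inordK; last by lia.
  by congr (x _ _ _); lia.
by rewrite ifF//; apply/negbTE/negP; rewrite inE /int_segment/= (negbTE h).
Qed.

Lemma exceedances_in_restrict a b (x : path) :
  exceedances_in a b (restrict_path (int_segment a b) x).
Proof.
move=> j; rewrite /restrict_path /patch; case: ifPn; first by rewrite inE.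
by rewrite /= is_norm0// ltr10.
Qed.

Lemma exceedances_in_pad m v : exceedances_in (- m%:Z) m%:Z (@pad m v).
Proof.
by move=> j; rewrite /pad; case: ifPn => // _; rewrite is_norm0// ltr10.
Qed.

Lemma ell0_pad m v : ell0 N (@pad m v).
Proof.
apply: (@ell0_eq_outside (- m%:Z) m%:Z (cst 0)).
  by move=> j hj; rewrite /pad ifF//; apply/negbTE/negP.
by move=> e e0; exists 0 => j _; rewrite /= is_norm0.
Qed.

Lemma pad_dist m (e : R) : 0 < e ->
  exists2 del : R, 0 < del &
    forall v w : 'M[R]_((2 * m).+1, d), `|v - w| < del -> forall j, N (pad v j - pad w j) < e.
Proof.
move=> e0; have [del del0 hdel] := is_norm_small hN e0.
exists del => // v w vw j; rewrite /pad; case: ifPn => _; last first.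
  by rewrite subrr is_norm0.
apply: hdel; move: vw; set i := inord _.
move=> hvw; have [_ vw] : ball v del w by rewrite -ball_normE.
suff : ball (row i v) del (row i w) by rewrite -ball_normE.
by split => // a l; rewrite !mxE; exact: vw.
Qed.

End anchored_functionals.

Section cluster_functional_theory.
Context {R : realType} {d : nat} (N : 'rV[R]_d -> R) (hN : is_norm N).
Notation path := (pathspace R d).
Context {dY : measure_display} {OmegaY : measurableType dY}
  {Q : probability OmegaY R} (Y : {RV Q >-> path}).
Context (H : path -> R) (hH : cluster_functional N Y H).

Definition spread_fun (k : nat) : path -> R := H \_ (ell0 N `&` spread N k).

Definition anchored_fun (k : nat) : path -> R :=
  H \_ (ell0 N `&` spread N k `&` anchored N).

Lemma cluster_functional_eq a b (x y : path) : ell0 N x -> ell0 N y ->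
  (forall j, (1 < N (x j)) = (1 < N (y j))) ->
  exceedances_in N a b x -> (forall j, int_segment a b j -> x j = y j) ->
  H x = H y.
Proof.
move=> hx hy hxy ex exy; have [x1|x1] := leP (star N setT x) 1%E.
  rewrite (cf_small hH hx x1) (cf_small hH)//.
  apply/star_le => j _; rewrite leNgt -hxy -leNgt.
  by move/star_le : x1; exact.
rewrite (cf_cluster hH hx x1) (cf_cluster hH hy).
  by rewrite (cluster_part_eq hxy ex exy).
by move/star_gt : x1 => [j _ xj]; apply/star_gt; exists j; rewrite // -hxy.
Qed.

Lemma mem_anchored_spread k (x y : path) : ell0 N x -> ell0 N y ->
  (forall j, (1 < N (x j)) = (1 < N (y j))) ->
  (x \in ell0 N `&` spread N k `&` anchored N) =
  (y \in ell0 N `&` spread N k `&` anchored N).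
Proof.
move=> hx hy hxy; have hyx j : (1 < N (y j)) = (1 < N (x j)) by rewrite hxy.
apply/idP/idP; rewrite !inE => -[[_ h1] h2].
  by split; [split => //; exact: spread_ext h1|exact: anchored_ext h2].
by split; [split => //; exact: spread_ext h1|exact: anchored_ext h2].
Qed.

Lemma anchored_fun_eq k a b (x y : path) : ell0 N x -> ell0 N y ->
  (forall j, (1 < N (x j)) = (1 < N (y j))) ->
  exceedances_in N a b x -> (forall j, int_segment a b j -> x j = y j) ->
  anchored_fun k x = anchored_fun k y.
Proof.
move=> hx hy hxy ex exy; rewrite /anchored_fun /patch.
by rewrite (cluster_functional_eq hx hy hxy ex exy) (mem_anchored_spread k hx hy hxy).
Qed.

Lemma anchored_fun_window_continuous k m (y : path) : ell0 N y ->
  (forall j, N (y j) != 1) -> exceedances_in N (- m%:Z) m%:Z y ->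
  ell0_continuous_at N H y ->
  forall e : R, 0 < e -> exists2 del : R, 0 < del &
    forall v, `|v - window (- m%:Z) (2 * m) y| < del ->
      `|anchored_fun k (pad v) - anchored_fun k y| < e.
Proof.
move=> hy y1 ey cy e e0.
have [d1 d10 hd1] := exceedances_stable hN hy y1.
have [d2 d20 hd2] := cy e e0.
have [del del0 hdel] := @pad_dist _ _ N hN m (Num.min d1 (d2 / 2))
  ltac:(by rewrite lt_min d10 divr_gt0).
exists del => // v hv.
(* [z] is uniformly close to [y], while [pad v] only shares its exceedances. *)
pose z : path := fun j => if - m%:Z <= j <= m%:Z then pad v j else y j.
have zv j : int_segment (- m%:Z) m%:Z j -> z j = pad v j.
  by rewrite /z => ->.
have zy j : N (z j - y j) < Num.min d1 (d2 / 2).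
  rewrite /z; case: ifPn => hj; last first.
    by rewrite subrr is_norm0// lt_min d10 divr_gt0.
  have := hdel _ _ hv j; rewrite pad_window /restrict_path patchT//.
  by rewrite inE.
have ellz : ell0 N z.
  apply: (@ell0_eq_outside _ _ N (- m%:Z) m%:Z y) => // j hj.
  by rewrite /z ifF//; apply/negbTE/negP.
have ezy : forall j, (1 < N (z j)) = (1 < N (y j)).
  by apply: hd1 => j; apply: lt_le_trans (zy j) _; rewrite ge_min lexx.
have ezv j : (1 < N (z j)) = (1 < N (pad v j)).
  have [hj|/negP hj] := boolP (- m%:Z <= j <= m%:Z); first by rewrite zv.
  rewrite ezy; apply/idP/idP => [/ey//|/(exceedances_in_pad hN)//].
have ez : exceedances_in N (- m%:Z) m%:Z z by move=> j; rewrite ezy; exact: ey.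
rewrite -(anchored_fun_eq k ellz (ell0_pad hN _) ezv ez zv).
have hz : `|H z - H y| < e.
  apply: hd2 => //; apply: (@le_lt_trans _ _ (d2 / 2)%:E).
    apply/star_le => j _; apply: ltW; apply: lt_le_trans (zy j) _.
    by rewrite ge_min lexx orbT.
  by rewrite lte_fin ltr_pdivrMr// mulr_natr mulr2n ltrDl.
rewrite /anchored_fun /patch (mem_anchored_spread k ellz hy ezy).
by case: ifP => _ //; rewrite subrr normr0.
Qed.

Lemma spread_fun_series (x : path) : ell0 N x ->
  (\sum_(0 <= k <oo) (spread_fun k x)%:E)%E =
  ((cluster_length N x - 1) * H x)%:E.
Proof.
move=> hx; have [x1|/star_gt[j0 _ xj0]] := leP (star N setT x) 1%E.
  rewrite (cf_small hH hx x1) mulr0 eseries0// => k _ _.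
  by rewrite /spread_fun /patch (cf_small hH hx x1); case: ifP.
have [a [b [xa xb hab]]] := ell0_exceedance_bounds hx xj0.
have := hab _ xa; rewrite /int_segment/= lexx/= => ab.
rewrite (cluster_length_eq xa xb hab) addrK.
have spreadE k : (x \in ell0 N `&` spread N k) = (k < absz (b - a)%R)%N.
  apply/idP/idP => [|kab].
    rewrite inE => -[_ [i [j [ij /hab + /hab]]]].
    by rewrite /int_segment/= => ? ?; lia.
  by rewrite inE; split => //; exists a, b; split => //; lia.
transitivity (\sum_(0 <= k < absz (b - a)%R) (spread_fun k x)%:E)%E.
  rewrite (nneseries_split 0 (absz (b - a)%R)) ?add0n; last first.
    by move=> k _; rewrite lee_fin /spread_fun /patch; case: ifP => // _; exact: cf_ge0 hH _ hx.
  rewrite [X in (_ + X)%E]eseries0 ?adde0// => k hk _.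
  by rewrite /spread_fun /patch spreadE ltnNge hk.
rewrite sumEFin; congr EFin.
rewrite (eq_big_nat _ _ (F2 := fun=> H x)); last first.
  by move=> k /andP[_ hk]; rewrite /spread_fun /patch spreadE hk.
rewrite big_const_nat subn0 iter_addr_0 -mulr_natl; congr (_ * _).
by rewrite natr_absz ger0_norm// subr_ge0.
Qed.

Lemma first_exceedance_decomposition r (x : path) :
  ell0 N x -> exceedances_in N 1 (2 * r)%N%:Z x ->
  \sum_(0 <= k < r) anchored_fun k (shift_path (r%:Z - k%:Z) x) =
  H x * \1_[set x : path | (exists2 j, int_segment 1 r%:Z j & 1 < N (x j)) /\
           exists2 j, int_segment r.+1%:Z (2 * r)%N%:Z j & 1 < N (x j)] x.
Proof.
move=> hx ex.
have anE k : anchored N (shift_path (r%:Z - k%:Z) x) <->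
    1 < N (x (r%:Z - k%:Z)) /\ forall j, j < r%:Z - k%:Z -> N (x j) <= 1.
  split=> -[h1 h2]; split.
  - by move: h1; rewrite /shift_path add0r.
  - by move=> j hj; have := h2 (j - (r%:Z - k%:Z)); rewrite /shift_path subrK subr_lt0; exact.
  - by rewrite /shift_path add0r.
  - by move=> j hj; apply: h2; lia.
have memE k : shift_path (r%:Z - k%:Z) x \in ell0 N `&` spread N k `&` anchored N ->
    spread N k x /\ anchored N (shift_path (r%:Z - k%:Z) x).
  by rewrite inE => -[[_ /spread_shift]].
rewrite indicE; have [|/negP] := boolP (x \in _); rewrite inE/=; last first.
  move=> hn; rewrite mulr0 big_nat big1// => k /andP[_ kr].
  rewrite /anchored_fun /patch ifF//; apply/negbTE/negP => /memE[[i [j [ij xi xj]]]].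
  move=> /anE[xk hk]; apply: hn; split.
    by exists (r%:Z - k%:Z) => //; rewrite /int_segment/=; lia.
  exists j => //; have := ex _ xj; rewrite /int_segment/=.
  have : r%:Z - k%:Z <= i by rewrite leNgt; apply/negP => /hk; rewrite leNgt xi.
  by lia.
move=> [[j1 j1r xj1] [j2 j2r xj2]]; rewrite mulr1.
have exP : exists n : nat, 1 < N (x n%:Z).
  by exists (absz j1); rewrite gez0_abs//; move: j1r; rewrite /int_segment/=; lia.
have [n xn hn] : exists2 n : nat, 1 < N (x n%:Z) & forall j : int, j < n%:Z -> N (x j) <= 1.
  exists (ex_minn exP); case: ex_minnP => // n _ hn j hj.
  rewrite leNgt; apply/negP => xj; have := ex _ xj; rewrite /int_segment/= => j1j.
  have := hn (absz j); rewrite gez0_abs ?xj; last by lia.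
  by move=> /(_ isT); lia.
have nr : (n <= r)%N.
  rewrite leqNgt; apply/negP => rn; move: j1r; rewrite /int_segment/= => j1r.
  by have := hn j1; rewrite leNgt xj1 => /(_ ltac:(lia)).
have n1 : (1 <= n)%N by have := ex _ xn; rewrite /int_segment/=; lia.
have rn : r%:Z - (r - n)%N%:Z = n%:Z by lia.
rewrite (big_cat_nat _ (n := (r - n)%N))//=; last by lia.
rewrite (@big_cat_nat _ _ _ (r - n).+1 (r - n)%N r)//=; last by lia.
rewrite big_nat1 big_nat big1 ?add0r; last first.
  move=> k hk; rewrite /anchored_fun /patch ifF//; apply/negbTE/negP => /memE[_ /anE[xk hk']].
  by have := hk' n%:Z; rewrite leNgt xn => /(_ ltac:(lia)).
rewrite [X in _ + X]big_nat big1 ?addr0; last first.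
  move=> k hk; rewrite /anchored_fun /patch ifF//; apply/negbTE/negP => /memE[_ /anE[xk _]].
  by have := hn (r%:Z - k%:Z); rewrite leNgt xk => /(_ ltac:(lia)).
rewrite /anchored_fun patchT ?(cf_shift hH)//.
rewrite inE; split; last by apply/anE; rewrite rn.
split; first exact: ell0_shift.
apply/spread_shift; exists n%:Z, j2; split => //.
by move: j2r; rewrite /int_segment/=; lia.
Qed.

End cluster_functional_theory.

Section measurability_of_functionals.
Context {R : realType} {d : nat} (N : 'rV[R]_d -> R) (hN : is_norm N).
Notation path := (pathspace R d).

Lemma countable_bigcapT_measurable d' (T : measurableType d') (I : countType)
    (F : I -> set T) :
  (forall i, measurable (F i)) -> measurable (\bigcap_i F i).
Proof.
move=> mF; rewrite -[X in measurable X]setCK setC_bigcap; apply: measurableC.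
by apply: countable_bigcupT_measurable => // i; exact: measurableC.
Qed.

Lemma measurable_lt_set d' (T : measurableType d') (f g : T -> R) :
  measurable_fun setT f -> measurable_fun setT g ->
  measurable [set x | f x < g x].
Proof.
move=> mf mg; have := measurable_fun_ltr mf mg measurableT (Y := [set true]).
by rewrite setTI; exact.
Qed.

Lemma measurable_norm_coordinate (j : int) :
  measurable_fun setT (fun x : path => N (x j)).
Proof. exact: measurable_coordinate_comp (is_norm_continuous hN). Qed.

Lemma measurable_norm_gt (j : int) (c : R) :
  measurable ([set x | c < N (x j)] : set path).
Proof.
exact: measurable_lt_set (measurable_cst _) (measurable_norm_coordinate j).
Qed.

Lemma measurable_norm_lt (j : int) (c : R) :
  measurable ([set x | N (x j) < c] : set path).
Proof.
exact: measurable_lt_set (measurable_norm_coordinate j) (measurable_cst _).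
Qed.

Lemma measurable_norm_le (j : int) (c : R) :
  measurable ([set x | N (x j) <= c] : set path).
Proof.
rewrite (_ : mkset _ = ~` [set x | c < N (x j)]).
  exact: measurableC (measurable_norm_gt _ _).
by apply/seteqP; split=> x /=; rewrite leNgt => /negP.
Qed.

Lemma ell0E : ell0 N = \bigcap_p \bigcup_m \bigcap_j
  [set x : path | (m <= `|j|)%N -> N (x j) < p.+1%:R^-1].
Proof.
apply/seteqP; split=> x hx.
  move=> p _; have [m hm] := hx p.+1%:R^-1 ltac:(by rewrite invr_gt0).
  by exists m => // j _ /hm.
move=> e e0.
have [p hp] : exists p : nat, p.+1%:R^-1 < e.
  by exists (Num.truncn e^-1); rewrite invf_plt ?posrE// truncnS_gt.
have [m _ hm] := hx p I; exists m => j hj; apply: lt_trans hp.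
exact: hm.
Qed.

Lemma measurable_ell0 : measurable (ell0 N).
Proof.
rewrite ell0E; apply: bigcapT_measurable => p; apply: bigcupT_measurable => m.
rewrite bigcap_mkcond; apply: (@countable_bigcapT_measurable _ _ int) => j; case: ifP => // _.
have [mj|mj] := leqP m `|j|.
  rewrite (_ : mkset _ = [set x | N (x j) < p.+1%:R^-1]).
    exact: measurable_norm_lt.
  by apply/seteqP; split=> x /=; [exact|].
by rewrite (_ : mkset _ = setT)//; apply/seteqP; split.
Qed.

Lemma measurable_spread k : measurable (@spread R d N k).
Proof.
rewrite (_ : spread N k = \bigcup_(i : int) \bigcup_(j in [set j : int | i + k.+1%:Z <= j])
   ([set x | 1 < N (x i)] `&` [set x | 1 < N (x j)])); last first.
  by apply/seteqP; split=> x [i]; [move=> [j [? ? ?]]; exists i => //; exists j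
    |move=> _ [j ? [? ?]]; exists i, j].
apply: (@countable_bigcupT_measurable _ _ int) => // i.
rewrite bigcup_mkcond; apply: (@countable_bigcupT_measurable _ _ int) => // j; case: ifP => // _.
by apply: measurableI; exact: measurable_norm_gt.
Qed.

Lemma measurable_no_past :
  measurable ([set x | forall j : int, j < 0 -> N (x j) <= 1] : set path).
Proof.
rewrite (_ : mkset _ = \bigcap_(j in [set j : int | j < 0]) [set x | N (x j) <= 1])//.
rewrite bigcap_mkcond; apply: (@countable_bigcapT_measurable _ _ int) => j; case: ifP => // _.
exact: measurable_norm_le.
Qed.

Lemma measurable_anchored : measurable (@anchored R d N).
Proof. by apply: measurableI; [exact: measurable_norm_gt|exact: measurable_no_past]. Qed.

Context {dY : measure_display} {OmegaY : measurableType dY}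
  {Q : probability OmegaY R} (Y : {RV Q >-> path}).
Context (H : path -> R) (hH : cluster_functional N Y H).

Lemma measurable_patch_ell0 (D : set path) : measurable D -> D `<=` ell0 N ->
  measurable_fun setT (H \_ D).
Proof.
move=> mD sD; apply/(measurable_restrictT _ mD).
exact: measurable_funS measurable_ell0 sD (cf_measurable hH).
Qed.

Lemma measurable_spread_fun k : measurable_fun setT (spread_fun N H k).
Proof.
apply: measurable_patch_ell0; last exact: subIsetl.
by apply: measurableI; [exact: measurable_ell0|exact: measurable_spread].
Qed.

Lemma measurable_anchored_fun k : measurable_fun setT (anchored_fun N H k).
Proof.
apply: measurable_patch_ell0; last by move=> x [[]].
apply: measurableI; last exact: measurable_anchored.
by apply: measurableI; [exact: measurable_ell0|exact: measurable_spread].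
Qed.

Lemma spread_fun_ge0 k x : 0 <= spread_fun N H k x.
Proof.
by rewrite /spread_fun /patch; case: ifPn => //; rewrite inE => -[/(cf_ge0 hH)].
Qed.

Lemma anchored_fun_ge0 k x : 0 <= anchored_fun N H k x.
Proof.
by rewrite /anchored_fun /patch; case: ifPn => //; rewrite inE => -[[/(cf_ge0 hH)]].
Qed.

Lemma anchored_fun_le M k x : (forall x, ell0 N x -> H x <= M) -> 0 <= M ->
  anchored_fun N H k x <= M * \1_(spread N k `&` anchored N) x.
Proof.
move=> HM M0; rewrite /anchored_fun /patch indicE; case: ifPn; last by rewrite mulr_ge0.
by rewrite inE => -[[hx h1] h2]; rewrite mem_set// mulr1 HM.
Qed.

End measurability_of_functionals.

Section lipschitz_envelope.
Context {R : realType} {V : normedModType R}.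

Definition lipschitz_envelope (f : V -> R) (p : nat) (v : V) : R :=
  sup [set f w - p%:R * `|v - w| | w in setT].

Context (f : V -> R) (M : R) (hf : forall v, `|f v| <= M).

Let bnd p v : has_sup [set f w - p%:R * `|v - w| | w in setT].
Proof.
split; first by exists (f v - p%:R * `|v - v|), v.
exists M => _ [w _ <-]; rewrite (le_trans _ (le_trans (ler_norm _) (hf w)))//.
by rewrite lerBlDr lerDl mulr_ge0.
Qed.

Lemma lipschitz_envelope_ge p v : f v <= lipschitz_envelope f p v.
Proof.
apply: ub_le_sup; first by have [] := bnd p v.
by exists v => //; rewrite subrr normr0 mulr0 subr0.
Qed.

Lemma lipschitz_envelope_le p v : lipschitz_envelope f p v <= M.
Proof.
apply: ge_sup; first by have [] := bnd p v.
move=> _ [w _ <-]; rewrite (le_trans _ (le_trans (ler_norm _) (hf w)))//.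
by rewrite lerBlDr lerDl mulr_ge0.
Qed.

Lemma lipschitz_envelope_bounded p v : `|lipschitz_envelope f p v| <= M.
Proof.
rewrite ler_norml lipschitz_envelope_le andbT.
apply: le_trans (lipschitz_envelope_ge p v).
by rewrite lerNl (le_trans (ler_norm _))// normrN.
Qed.

Lemma lipschitz_envelope_lip p v w :
  lipschitz_envelope f p v <= lipschitz_envelope f p w + p%:R * `|v - w|.
Proof.
apply: ge_sup; first by have [] := bnd p v.
move=> _ [z _ <-]; rewrite -lerBlDr.
have : f z - p%:R * `|w - z| <= lipschitz_envelope f p w.
  by apply: ub_le_sup; [have [] := bnd p w|exists z].
apply: le_trans; rewrite -addrA lerD2l -opprD lerN2 -mulrDr ler_wpM2l//.
by have := ler_distD v w z; rewrite (distrC w v) [_ + `|v - z|]addrC.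
Qed.

Lemma lipschitz_envelope_continuous p : continuous (lipschitz_envelope f p).
Proof.
move=> v; apply/(@cvgrPdist_lt _ _ _ (nbhs v)) => e e0.
have d0 : 0 < e / p.+1%:R by rewrite divr_gt0.
have : nbhs v (ball v (e / p.+1%:R)) by exact: nbhsx_ballx.
apply: filterS => w; rewrite -ball_normE/= ltr_pdivlMr// => hw.
apply: le_lt_trans hw; apply: (@le_trans _ _ (p%:R * `|v - w|)); last first.
  by rewrite mulrC ler_wpM2l// ler_nat.
have := lipschitz_envelope_lip p v w; have := lipschitz_envelope_lip p w v.
by rewrite (distrC w v) ler_norml => h1 h2; apply/andP; split; lra.
Qed.

Lemma lipschitz_envelope_cvg v :
  (forall e, 0 < e -> exists2 del : R, 0 < del &
    forall w, `|w - v| < del -> `|f w - f v| < e) ->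
  lipschitz_envelope f p v @[p --> \oo] --> f v.
Proof.
move=> hc; apply/cvgrPdist_le => e e0; have [del del0 hdel] := hc e e0.
have M0 : 0 <= M by exact: le_trans (hf v).
near=> p; rewrite ler0_norm ?subr_le0 ?lipschitz_envelope_ge// opprB lerBlDl.
apply: ge_sup; first by have [] := bnd p v.
move=> _ [w _ <-]; have [hw|hw] := ltP `|w - v| del.
  have := hdel w hw; rewrite ltr_norml => /andP[_ h].
  by rewrite lerBlDr (le_trans (ltW _ : f w <= f v + e)) ?lerDl ?mulr_ge0// -ltrBlDl.
have hp : M + M <= p%:R * del.
  by rewrite -ler_pdivrMr//; near: p; exact: nbhs_infty_ger.
have : p%:R * del <= p%:R * `|v - w| by rewrite ler_wpM2l// distrC.
move: (hf w) (hf v); rewrite !ler_norml => /andP[_ ?] /andP[? _] ?; lra.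
Unshelve. all: by end_near. Qed.

End lipschitz_envelope.

(** * Weak limits of the rescaled windows *)

Section real_expectations.
Context {R : realType} {dT : measure_display} {T : measurableType dT}
  (P : probability T R).

Lemma bounded_integrable (f : T -> R) (M : R) :
  measurable_fun setT f -> (forall x, `|f x| <= M) ->
  P.-integrable setT (EFin \o f).
Proof.
move=> mf fM; apply: measurable_bounded_integrable => //.
  by rewrite ltey_eq fin_num_measure.
exists M; split; first exact: num_real.
by move=> y My x _; exact: le_trans (fM x) (ltW My).
Qed.

Lemma Rintegral_indic (A : set T) : measurable A ->
  \int[P]_x (\1_A x : R) = prob (P := P) A.
Proof. by move=> mA; rewrite /Rintegral integral_indic// setIT. Qed.

Lemma Rintegral_cst_indic (M : R) (A : set T) : measurable A ->
  \int[P]_x (M * \1_A x) = M * prob (P := P) A.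
Proof.
move=> mA; rewrite RintegralZl// ?Rintegral_indic//.
apply: (@bounded_integrable _ 1) => // x; rewrite indicE.
by rewrite ger0_norm// lern1 leq_b1.
Qed.

Lemma prob_ge0 (A : set T) : 0 <= prob (P := P) A.
Proof. exact: fine_ge0. Qed.

Lemma le_prob (A B : set T) : measurable A -> measurable B -> A `<=` B ->
  prob (P := P) A <= prob (P := P) B.
Proof.
by move=> mA mB AB; apply: fine_le; rewrite ?fin_num_measure// le_measure// inE.
Qed.

Lemma prob_bigcup_le (I : eqType) (s : seq I) (F : I -> set T) (A : set T) :
  measurable A -> (forall i, measurable (F i)) ->
  (forall x, A x -> exists2 i, i \in s & F i x) ->
  prob (P := P) A <= \sum_(i <- s) prob (P := P) (F i).
Proof.
move=> mA mF; elim: s A mA => [|i s IH] A mA AF.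
  rewrite big_nil (_ : A = set0) /prob ?measure0//.
  by apply/seteqP; split=> // x /AF[].
rewrite big_cons.
have mAF : measurable (A `\` F i) by exact: measurableD.
apply: (@le_trans _ _ (prob (P := P) (F i) + prob (P := P) (A `\` F i))); last first.
  rewrite lerD2l; apply: IH => // x [/AF[j]]; rewrite inE => /predU1P[->//|js] Fj nFi; by exists j.
rewrite -lee_fin EFinD /prob !fineK ?fin_num_measure//.
apply: (@le_trans _ _ (P (F i `|` (A `\` F i)))).
  by apply: le_measure; rewrite ?inE//; [exact: measurableU|move=> x Ax; have [|] := pselect (F i x); [left|right]].
exact: measureU2.
Qed.

Lemma prob_disjoint_le (A B C : set T) :
  measurable A -> measurable B -> measurable C ->
  (forall x, A x -> ~ B x) -> A `<=` C -> B `<=` C ->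
  prob (P := P) A + prob (P := P) B <= prob (P := P) C.
Proof.
move=> mA mB mC AB AC BC; apply: (@le_trans _ _ (prob (P := P) (A `|` B))).
  rewrite /prob measureU//; first by rewrite fineD// fin_num_measure.
  by apply/seteqP; split=> // x [/AB].
by apply: le_prob => //; [exact: measurableU|move=> x [/AC|/BC]].
Qed.

Lemma cvg_Rintegral (f : nat -> T -> R) (g : T -> R) (M : R) :
  (forall n, measurable_fun setT (f n)) -> measurable_fun setT g ->
  (forall n x, `|f n x| <= M) -> (forall x, f n x @[n --> \oo] --> g x) ->
  \int[P]_x f n x @[n --> \oo] --> \int[P]_x g x.
Proof.
move=> mf mg fM fg.
have gM x : `|g x| <= M.
  apply: (cvgr_to_le (f := fun n => `|f n x|) (cvg_norm (fg x))).
  by apply: nearW => n; exact: fM.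
have [_ _] := @dominated_convergence _ T R P setT measurableT
  (fun n => EFin \o f n) (EFin \o g) (cst M%:E)
  ltac:(by move=> n; apply/measurable_EFinP) ltac:(by apply/measurable_EFinP)
  ltac:(by apply: aeW => x _; apply: cvg_EFin; [exact: nearW|exact: fg])
  ltac:(by apply: (@bounded_integrable (cst M) `|M|))
  ltac:(by apply: aeW => x n _; rewrite lee_fin).
move=> h; apply: fine_cvg.
rewrite [X in _ --> X]fineK//.
by apply: integrable_fin_num => //; exact: (bounded_integrable mg gM).
Qed.

End real_expectations.

Section tail_limits.
Context {R : realType} {d : nat} (N : 'rV[R]_d -> R) (hN : is_norm N).
Notation path := (pathspace R d).
Context {dX : measure_display} {Omega : measurableType dX}
  {P : probability Omega R} (X : {RV P >-> path}).
Context {dY : measure_display} {OmegaY : measurableType dY}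
  {Q : probability OmegaY R} (Y : {RV Q >-> path}).
Context (hY : tail_process N X Y) (u : nat -> R) (w : nat -> R)
  (hw : forall n, w n = prob (P := P) (exceedance N X (u n)))
  (hu : u n @[n --> \oo] --> +oo).

Lemma measurable_exceedance c : measurable (exceedance N X c).
Proof.
rewrite -[X in measurable X]setTI.
exact: (@measurable_funPT _ _ _ _ X) _ _ (measurable_norm_gt hN 0 c).
Qed.

Lemma tail_process_cvg i m (f : 'M[R]_(m.+1, d) -> R) (M : R) :
  continuous f -> (forall v, `|f v| <= M) ->
  (w n)^-1 * \int[P]_o (f (window i m (scale_path (u n)^-1 (X o)))
                        * \1_(exceedance N X (u n)) o)
    @[n --> \oo] --> \int[Q]_o f (window i m (Y o)).
Proof.
move=> cf fM; have := cvg_comp _ _ hu (@hY i m f cf (ex_intro _ M fM)).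
rewrite [X in _ -> _ --> X](_ : _ = fine ('E_Q[fun o => f (window i m (Y o))])%E); last first.
  by rewrite unlock.
by under eq_cvg do rewrite /= unlock mulrC -hw.
Qed.

Lemma tail_process_limsup i m (f : 'M[R]_(m.+1, d) -> R) (M : R)
    (B : set OmegaY) (G : OmegaY -> R) :
  (forall v, `|f v| <= M) ->
  (forall n, measurable_fun setT (fun o => f (window i m (scale_path (u n)^-1 (X o))))) ->
  measurable B -> measurable_fun setT G -> (forall o, `|G o| <= M) ->
  (forall o, B o -> f (window i m (Y o)) = G o) ->
  (forall o, B o -> forall e, 0 < e -> exists2 del : R, 0 < del &
     forall v, `|v - window i m (Y o)| < del ->
       `|f v - f (window i m (Y o))| < e) ->
  forall e, 0 < e -> \forall n \near \oo,
    (w n)^-1 * \int[P]_o (f (window i m (scale_path (u n)^-1 (X o)))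
                        * \1_(exceedance N X (u n)) o)
    <= \int[Q]_o G o + (M + M) * prob (P := Q) (~` B) + e.
Proof.
move=> fM mf mB mG GM fG cf e e0.
pose U p (o : OmegaY) := lipschitz_envelope f p (window i m (Y o)).
have mX : measurable_fun setT X by exact: measurable_funPT.
have mY : measurable_fun setT Y by exact: measurable_funPT.
have mU p : measurable_fun setT (U p).
  exact: (measurableT_comp
    (measurable_window_comp i (lipschitz_envelope_continuous fM (p := p))) mY).
have UM p o : `|U p o| <= M by exact: lipschitz_envelope_bounded.
have M0 : 0 <= M by exact: le_trans (fM 0).
have mI (A : set OmegaY) : measurable A -> measurable_fun setT (\1_A : OmegaY -> R).
  by move=> mA; exact: measurable_indic.
have bI (T : Type) (A : set T) (g : T -> R) o : `|g o| <= M -> `|g o * \1_A o| <= M.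
  move=> h; rewrite normrM indicE; case: (o \in A); rewrite ?normr1 ?mulr1//.
  by rewrite normr0 mulr0.
have h1 : \int[Q]_o (U p o * \1_B o) @[p --> \oo] --> \int[Q]_o (G o * \1_B o).
  apply: (@cvg_Rintegral _ _ _ _ _ _ M) => //.
  - by move=> p; apply: measurable_funM => //; exact: mI.
  - by apply: measurable_funM => //; exact: mI.
  - by move=> p o; exact: bI.
  - move=> o; have [Bo|nBo] := pselect (B o).
      rewrite indicE mem_set// mulr1; under eq_cvg do rewrite mulr1.
      by rewrite -fG//; apply: lipschitz_envelope_cvg => // e'; exact: cf.
    rewrite indicE memNset// mulr0; under eq_cvg do rewrite mulr0.
    exact: cvg_cst.
have [p hp] : exists p, \int[Q]_o (U p o * \1_B o) <= \int[Q]_o (G o * \1_B o) + e / 2.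
  have : \forall p \near \oo, \int[Q]_o (U p o * \1_B o) <= \int[Q]_o (G o * \1_B o) + e / 2.
    by apply: cvgr_le h1 _ _; rewrite ltrDl divr_gt0.
  by move=> [p _ h]; exists p; apply: h => /=.
have hU : \int[Q]_o U p o <= \int[Q]_o G o + (M + M) * prob (P := Q) (~` B) + e / 2.
  have mB' : measurable (~` B) by exact: measurableC.
  have iI (g : OmegaY -> R) A : measurable_fun setT g -> (forall o, `|g o| <= M) ->
      measurable A -> Q.-integrable setT (EFin \o (fun o => g o * \1_A o)).
    move=> mg gM mA; apply: (@bounded_integrable _ _ _ _ _ M).
      by apply: measurable_funM => //; exact: mI.
    by move=> o; exact: bI.
  have iM : Q.-integrable setT (EFin \o (fun o => M * \1_(~` B) o)).
    by apply: iI => // o; rewrite ger0_norm.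
  have iU : Q.-integrable setT (EFin \o U p) by exact: (bounded_integrable Q (mU p) (UM p)).
  have iG : Q.-integrable setT (EFin \o G) by exact: (bounded_integrable Q mG GM).
  have eM := Rintegral_cst_indic Q M mB'.
  have indE o : \1_(~` B) o = 1 - \1_B o :> R.
    by rewrite !indicE in_setC; case: (o \in B); rewrite ?subrr ?subr0.
  have ind01 o : 0 <= (\1_B o : R) <= 1 by rewrite indicE; case: (o \in B); rewrite /= ?lexx ?ler01.
  have h2 : \int[Q]_o U p o <= \int[Q]_o (U p o * \1_B o) + M * prob (P := Q) (~` B).
    rewrite -eM -RintegralD//; last exact: iI.
    apply: le_Rintegral => //.
      by apply: (@bounded_integrable _ _ _ _ _ (M + M)); [
        apply: measurable_funD; apply: measurable_funM => //; exact: mI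
        |move=> o; rewrite (le_trans (ler_normD _ _))// lerD ?bI// ger0_norm].
    move=> o _; rewrite indE; have := ind01 o; have := UM p o; rewrite ler_norml; nra.
  have h3 : \int[Q]_o (G o * \1_B o) <= \int[Q]_o G o + M * prob (P := Q) (~` B).
    rewrite -eM -RintegralD//; apply: le_Rintegral => //.
    - exact: iI.
    - by apply: (@bounded_integrable _ _ _ _ _ (M + M)); [
        apply: measurable_funD => //; apply: measurable_funM => //; exact: mI
        |move=> o; rewrite (le_trans (ler_normD _ _))// lerD ?bI// ger0_norm].
    - move=> o _; rewrite indE; have := ind01 o; have := GM o; rewrite ler_norml; nra.
  lra.
have := tail_process_cvg (i := i) (lipschitz_envelope_continuous fM (p := p))
  (lipschitz_envelope_bounded fM p).
move=> /cvgr_le /(_ (\int[Q]_o U p o + e / 2)); rewrite ltrDl divr_gt0// => /(_ isT).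
apply: filterS => n hn.
have : (w n)^-1 * \int[P]_o (f (window i m (scale_path (u n)^-1 (X o)))
                        * \1_(exceedance N X (u n)) o) <=
   (w n)^-1 * \int[P]_o (lipschitz_envelope f p (window i m (scale_path (u n)^-1 (X o)))
                        * \1_(exceedance N X (u n)) o).
  rewrite ler_wpM2l ?invr_ge0 ?hw ?prob_ge0//.
  have mE := measurable_exceedance (u n).
  have mI' : measurable_fun setT (\1_(exceedance N X (u n)) : Omega -> R).
    exact: measurable_indic.
  apply: le_Rintegral => //.
  - apply: (@bounded_integrable _ _ _ _ _ M); first exact: measurable_funM.
    move=> o.
    exact: (@bI _ _ (fun o => f (window i m (scale_path (u n)^-1 (X o)))) o (fM _)).
  - apply: (@bounded_integrable _ _ _ _ _ M); last first.
      move=> o; exact: (@bI _ _ (fun o => lipschitz_envelope f p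
        (window i m (scale_path (u n)^-1 (X o)))) o (lipschitz_envelope_bounded fM _ _)).
    apply: measurable_funM => //.
    exact: (measurableT_comp (measurable_window_comp i
      (lipschitz_envelope_continuous fM (p := p)))
      (measurableT_comp (@measurable_scale_path _ _ (u n)^-1) mX)).
  - move=> o _; rewrite ler_wpM2r//; exact: lipschitz_envelope_ge.
move=> /le_trans; apply; move: hn => /= hn; apply: le_trans hn _; lra.
Qed.

End tail_limits.

(** * Regularity of the tail process *)

Section near_one.
Context {R : realType}.

Lemma powR_near1 (a e : R) : 0 < e -> exists2 del : R, 0 < del < 1 &
  `|(1 - del) `^ a - 1| <= e /\ `|(1 + del) `^ a - 1| <= e.
Proof.
move=> e0.
have c : expR (a * ln x) @[x --> (1 : R)] --> (1 : R).
  rewrite -[X in _ --> X](_ : expR (a * ln 1) = 1); last by rewrite ln1 mulr0 expR0.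
  apply: continuous_cvg; first exact: continuous_expR.
  by apply: cvgMr; apply: continuous_ln; exact: ltr01.
have := cvgr_dist_le _ _ c _ e0 => -[del /= del0 hdel].
pose t := Num.min (del / 2) 2^-1.
have t0 : 0 < t by rewrite lt_min divr_gt0//= invr_gt0.
have td : t < del by rewrite gt_min ltr_pdivrMr// mulr_natr mulr2n ltrDl del0.
have t1 : t < 1 by rewrite gt_min invf_lt1// ltr1n orbT.
exists t; first by rewrite t0.
have h (x : R) : `|1 - x| < del -> 0 < x -> `|x `^ a - 1| <= e.
  move=> xd x0; rewrite distrC /powR gt_eqF//.
  exact: hdel xd.
split; apply: h; rewrite ?subr_gt0// ?addr_gt0//.
  by rewrite opprB addrC subrK gtr0_norm.
by rewrite opprD addNKr normrN gtr0_norm.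
Qed.

Lemma sum_le_weighted_sum (l b : nat) (c : nat -> R) : (forall i, 0 <= c i) ->
  \sum_(l.+1 <= i < b) c i <= \sum_(l <= i < b) i%:R * c i.
Proof.
move=> c0; have [lb|bl] := ltnP l b; last by rewrite !big_geq// leqW.
rewrite [leRHS]big_ltn//; apply: (@le_trans _ _ (\sum_(l.+1 <= i < b) i%:R * c i)).
  rewrite !big_nat; apply: ler_sum => i /andP[li _].
  by rewrite ler_peMl// ler1n (leq_trans _ li).
by rewrite lerDr mulr_ge0.
Qed.

Lemma limn_esup_lt (v : nat -> \bar R) (l : \bar R) : (limn_esup v < l)%E ->
  \forall n \near \oo, (v n < l)%E.
Proof.
rewrite limn_esup_lim (cvg_lim _ (@cvg_esups_inf _ v))//.
move=> /ereal_inf_lt[_ [n _ <-] h].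
exists n => // k nk; apply: le_lt_trans h.
by apply: ereal_sup_ubound; exists k.
Qed.

End near_one.

Section tail_process_regularity.
Context {R : realType} {d : nat} (N : 'rV[R]_d -> R) (hN : is_norm N).
Notation path := (pathspace R d).
Context {dX : measure_display} {Omega : measurableType dX}
  {P : probability Omega R} (X : {RV P >-> path}).
Context {dY : measure_display} {OmegaY : measurableType dY}
  {Q : probability OmegaY R} (Y : {RV Q >-> path}).
Context (alpha : R) (hX : stationary X) (hindex : tail_index N X alpha).
Context (hY : tail_process N X Y) (u : nat -> R) (w : nat -> R)
  (hw : forall n, w n = prob (P := P) (exceedance N X (u n)))
  (hu0 : forall n, 0 < u n)
  (hu : u n @[n --> \oo] --> +oo)
  (w0 : \forall n \near \oo, 0 < w n).

Lemma measurable_preimageX (A : set path) : measurable A ->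
  measurable [set o | A (X o)].
Proof. by move=> mA; rewrite -[X in measurable X]setTI; apply: (@measurable_funPT _ _ _ _ X). Qed.

Lemma measurable_preimageY (A : set path) : measurable A ->
  measurable [set o | A (Y o)].
Proof. by move=> mA; rewrite -[X in measurable X]setTI; apply: (@measurable_funPT _ _ _ _ Y). Qed.

Lemma measurable_joint_exceedance i a b :
  measurable [set o | a < N (X o 0) /\ b < N (X o i)].
Proof.
apply: measurableI; first exact: measurable_preimageX (measurable_norm_gt hN 0 a).
exact: measurable_preimageX (measurable_norm_gt hN i b).
Qed.

Lemma prob_exceedance_shift c j :
  prob (P := P) [set o | c < N (X o j)] = prob (P := P) (exceedance N X c).
Proof.
have := hX j (measurable_norm_gt hN 0 c).
by rewrite /prob/= /shift_path add0r => ->.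
Qed.

Lemma prob_joint_exceedance_opp i a b :
  prob (P := P) [set o | a < N (X o 0) /\ b < N (X o (- i))] =
  prob (P := P) [set o | b < N (X o 0) /\ a < N (X o i)].
Proof.
have := hX i (measurableI _ _ (measurable_norm_gt hN 0 a) (measurable_norm_gt hN (- i) b)).
rewrite /prob/= /shift_path/= add0r addNr => <-; congr (fine (P _)).
by apply/seteqP; split => o [].
Qed.

Lemma tail_ratio_cvg t : 0 < t ->
  (w n)^-1 * prob (P := P) (exceedance N X (t * u n)) @[n --> \oo] --> t `^ (- alpha).
Proof.
move=> t0; have := cvg_comp _ _ hu (hindex t0).
by under [in X in X -> _]eq_cvg do rewrite /= mulrC -hw.
Qed.

Lemma measurable_tail_coordinate n (j : int) (phi : R -> R) : continuous phi ->
  measurable [set o | u n < N (X o 0) /\ phi ((u n)^-1 * N (X o j)) < 1].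
Proof.
move=> cphi; have mphi : measurable_fun setT phi by exact: continuous_measurable_fun.
apply: measurableI; first exact: measurable_preimageX (measurable_norm_gt hN 0 _).
apply: measurable_lt_set => //; apply: (measurableT_comp mphi).
apply: measurable_funM => //.
by apply: (measurableT_comp (measurable_norm_coordinate hN j)); exact: measurable_funPT.
Qed.

Lemma tail_coordinate_sandwich (j : int) (phi : R -> R) : continuous phi ->
  exists (a : nat -> R) (l : R), [/\ a n @[n --> \oo] --> l,
    forall n, a n <= (w n)^-1 *
     prob (P := P) [set o | u n < N (X o 0) /\ phi ((u n)^-1 * N (X o j)) < 1] &
    prob (P := Q) [set o | phi (N (Y o j)) <= 0] <= l].
Proof.
move=> cphi.
pose h (s : R) := Num.max 0 (1 - Num.max 0 (phi s)).
have ch : continuous h.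
  move=> s; apply: (continuous_max (f := cst 0) (g := fun s => 1 - Num.max 0 (phi s))).
    exact: cvg_cst.
  apply: cvgB; first exact: cvg_cst.
  by apply: (continuous_max (f := cst 0) (g := phi)); [exact: cvg_cst|exact: cphi].
have h0 s : 0 <= h s by rewrite le_max lexx.
have h1 s : h s <= 1 by rewrite ge_max ler01/= gerBl le_max lexx.
have hb s : `|h s| <= 1 by rewrite ger0_norm.
pose f (v : 'M[R]_(1, d)) := h (N v).
have cf : continuous f.
  move=> v; exact: (@continuous_comp _ _ _ N h v (is_norm_continuous hN (x := v)) (ch (N v))).
have fE (x : path) : f (window j 0 x) = h (N (x j)).
  by congr (h (N _)); apply/rowP => l; rewrite mxE addr0.
have := tail_process_cvg (X := X) (Q := Q) hY hw hu (i := j) cf (fun v => hb _).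
have mphi : measurable_fun setT phi by exact: continuous_measurable_fun.
have mY : measurable_fun setT Y by exact: measurable_funPT.
have mX : measurable_fun setT X by exact: measurable_funPT.
have mNY : measurable_fun setT (fun o => N (Y o j)).
  exact: (measurableT_comp (measurable_norm_coordinate hN j) mY).
have mNX : measurable_fun setT (fun o => N (X o j)).
  exact: (measurableT_comp (measurable_norm_coordinate hN j) mX).
have mA : measurable [set o | phi (N (Y o j)) <= 0].
  rewrite (_ : mkset _ = ~` [set o | 0 < phi (N (Y o j))]).
    apply: measurableC; apply: measurable_lt_set => //.
    exact: (measurableT_comp mphi mNY).
  by apply/seteqP; split=> o /=; rewrite leNgt => /negP.
move=> hcv; eexists; eexists; split; first exact: hcv; last first.
  rewrite -Rintegral_indic//; apply: le_Rintegral => //.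
  - by apply: (@bounded_integrable _ _ _ _ _ 1) => // o; rewrite indicE ger0_norm// lern1 leq_b1.
  - apply: (@bounded_integrable _ _ _ _ _ 1); last by move=> o; exact: hb.
    exact: (measurableT_comp (measurable_window_comp j cf) mY).
  - move=> o _; rewrite fE indicE; case: (boolP (o \in _)) => //=; rewrite inE/= => ho.
    by rewrite /h [Num.max 0 (phi _)]max_l// subr0 le_max lexx orbT.
move=> n; rewrite ler_wpM2l ?invr_ge0 ?hw ?prob_ge0//.
have mA' := measurable_tail_coordinate n j cphi.
rewrite -[leRHS]Rintegral_indic//; apply: le_Rintegral => //.
- apply: (@bounded_integrable _ _ _ _ _ 1).
    apply: measurable_funM; last by apply: measurable_indic; exact: measurable_exceedance.
    exact: (measurableT_comp (measurable_window_comp j cf) (measurableT_comp (@measurable_scale_path _ _ (u n)^-1) mX)).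
  move=> o; rewrite normrM indicE; case: (o \in _); last by rewrite normr0 mulr0.
  by rewrite normr1 mulr1; exact: hb.
- by apply: (@bounded_integrable _ _ _ _ _ 1) => // o; rewrite indicE ger0_norm// lern1 leq_b1.
- move=> o _; rewrite fE !indicE.
  have [ho|ho] := boolP (o \in exceedance N X (u n)); last by rewrite mulr0.
  rewrite mulr1; have [ho'|ho'] := ltP (phi ((u n)^-1 * N (X o j))) 1.
    by rewrite mem_set//; split => //; move: ho; rewrite inE.
  rewrite /scale_path (norm_scale hN) ger0_norm ?invr_ge0 ?(ltW (hu0 n))//.
  rewrite (_ : h _ = 0)//; apply: max_l; rewrite subr_le0.
  by rewrite le_max ho' orbT.
Qed.

Lemma tail_coordinate_le (j : int) (phi : R -> R) (c : R) : continuous phi ->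
  (forall e, 0 < e -> \forall n \near \oo, (w n)^-1 *
     prob (P := P) [set o | u n < N (X o 0) /\ phi ((u n)^-1 * N (X o j)) < 1] <= c + e) ->
  prob (P := Q) [set o | phi (N (Y o j)) <= 0] <= c.
Proof.
move=> cphi hc; have [a [l [al ha hl]]] := tail_coordinate_sandwich j cphi.
apply: (le_trans hl); apply/ler_addgt0Pr => e e0.
by apply: (cvgr_to_le al); move: (hc e e0); apply: filterS => n; exact: le_trans.
Qed.

Lemma tail_process_not_one j : prob (P := Q) [set o | N (Y o j) = 1] = 0.
Proof.
apply/eqP; rewrite eq_le prob_ge0 andbT; apply/ler_addgt0Pr => e e0; rewrite add0r.
have e20 : 0 < e / 2 by rewrite divr_gt0.
have [del /andP[del0 del1] [hm hp]] := powR_near1 (- alpha) e20.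
pose phi (s : R) := `|s - 1| / del.
have cphi : continuous phi.
  move=> s; apply: cvgM; last exact: cvg_cst.
  by apply: cvg_norm; apply: cvgB; [exact: cvg_id|exact: cvg_cst].
rewrite (_ : mkset _ = [set o | phi (N (Y o j)) <= 0]); last first.
  apply/seteqP; split=> o /=; rewrite /phi; first by move=> ->; rewrite subrr normr0 mul0r.
  by rewrite pmulr_lle0 ?invr_gt0// normr_le0 subr_eq0 => /eqP.
apply: tail_coordinate_le => // e' e'0.
have d1 : 0 < 1 - del by rewrite subr_gt0.
have d2 : 0 < 1 + del by rewrite addr_gt0.
have c1 := cvgr_le _ (tail_ratio_cvg d1) ((1 - del) `^ (- alpha) + e' / 2) ltac:(by rewrite ltrDl divr_gt0).
have c2 := cvgr_ge _ (tail_ratio_cvg d2) ((1 + del) `^ (- alpha) - e' / 2) ltac:(by rewrite ltrBlDr ltrDl divr_gt0).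
near=> n.
have h1 : (w n)^-1 * prob (P := P) (exceedance N X ((1 - del) * u n)) <= (1 - del) `^ (- alpha) + e' / 2.
  by near: n; exact: c1.
have h2 : (1 + del) `^ (- alpha) - e' / 2 <= (w n)^-1 * prob (P := P) (exceedance N X ((1 + del) * u n)).
  by near: n; exact: c2.
have iw : 0 <= (w n)^-1 by rewrite invr_ge0 hw prob_ge0.
have u0 := hu0 n.
have h3 : prob (P := P) [set o | u n < N (X o 0) /\ phi ((u n)^-1 * N (X o j)) < 1] +
    prob (P := P) (exceedance N X ((1 + del) * u n)) <= prob (P := P) (exceedance N X ((1 - del) * u n)).
  rewrite -!(prob_exceedance_shift _ j); apply: prob_disjoint_le.
  - exact: measurable_tail_coordinate.
  - exact: measurable_preimageX (measurable_norm_gt hN j _).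
  - exact: measurable_preimageX (measurable_norm_gt hN j _).
  - move=> o [_]; rewrite /phi/= ltr_pdivrMr// mul1r ltr_norml => /andP[_ h3].
    by apply/negP; rewrite -leNgt -ler_pdivrMr// mulrC; lra.
  - move=> o [_]; rewrite /phi/= ltr_pdivrMr// mul1r ltr_norml => /andP[h3 _].
    by rewrite -ltr_pdivlMr// mulrC; lra.
  - by move=> o; apply: le_lt_trans; rewrite ler_pM2r//; lra.
have := ler_wpM2l iw h3; rewrite mulrDr.
move: hm hp; rewrite !ler_norml => /andP[_ ?] /andP[? _] ?; lra.
Unshelve. all: by end_near. Qed.

Lemma tail_process_gt_one : prob (P := Q) [set o | N (Y o 0) <= 1] = 0.
Proof.
apply/eqP; rewrite eq_le prob_ge0 andbT; apply/ler_addgt0Pr => e e0; rewrite add0r.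
have [del /andP[del0 del1] [hm hp]] := powR_near1 (- alpha) e0.
pose phi (s : R) := (s - 1) / del.
have cphi : continuous phi.
  move=> s; apply: cvgM; last exact: cvg_cst.
  by apply: cvgB; [exact: cvg_id|exact: cvg_cst].
rewrite (_ : mkset _ = [set o | phi (N (Y o 0)) <= 0]); last first.
  by apply/seteqP; split=> o /=; rewrite /phi pmulr_lle0 ?invr_gt0// subr_le0.
apply: tail_coordinate_le => // e' e'0.
have d2 : 0 < 1 + del by rewrite addr_gt0.
have c2 := cvgr_ge _ (tail_ratio_cvg d2) ((1 + del) `^ (- alpha) - e') ltac:(by rewrite ltrBlDr ltrDl).
near=> n.
have wn0 : 0 < w n by near: n.
have h2 : (1 + del) `^ (- alpha) - e' <= (w n)^-1 * prob (P := P) (exceedance N X ((1 + del) * u n)).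
  by near: n; exact: c2.
have u0 := hu0 n.
have h3 : prob (P := P) [set o | u n < N (X o 0) /\ phi ((u n)^-1 * N (X o 0)) < 1] +
    prob (P := P) (exceedance N X ((1 + del) * u n)) <= w n.
  rewrite hw; apply: prob_disjoint_le; try exact: measurable_exceedance.
  - exact: measurable_tail_coordinate.
  - move=> o [_]; rewrite /phi/= ltr_pdivrMr// mul1r => h3.
    by apply/negP; rewrite -leNgt -ler_pdivrMr// mulrC; lra.
  - by move=> o [].
  - by move=> o; apply: le_lt_trans; rewrite ler_peMl ?ltW//; lra.
have := ler_wpM2l (ltW (_ : 0 < (w n)^-1)) h3; rewrite invr_gt0 => /(_ wn0).
rewrite mulrDr mulVf ?gt_eqF//.
move: hp; rewrite !ler_norml => /andP[? _] ?; lra.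
Unshelve. all: by end_near. Qed.

Lemma anticlustering_tail (r : nat -> nat) (s t : R) :
  anticlustering N X 1 r u -> 0 < s -> 0 < t -> forall e, 0 < e ->
  exists l, \forall n \near \oo, (w n)^-1 * \sum_(l <= i < (r n).+1) (i%:R *
    prob (P := P) [set o | u n * s < N (X o 0) /\ u n * t < N (X o i%:Z)]) <= e.
Proof.
move=> hS s0 t0 e e0; have := hS s t s0 t0.
move=> /(_ [set x | (x < e%:E)%E]) -[|l _ /(_ l (leqnn l))/= hl].
  by apply: open_nbhs_nbhs; split; [exact: open_ereal_lt_ereal|rewrite /= lte_fin].
exists l; have := limn_esup_lt hl; apply: filterS => n; rewrite lte_fin => /ltW.
by under eq_bigr do rewrite powRr1//; rewrite hw.
Qed.

Lemma tail_process_summable (r : nat -> nat) (t : R) (j : nat -> int) :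
  r n @[n --> \oo] --> \oo -> 0 < t ->
  (exists l, \forall n \near \oo, (w n)^-1 * \sum_(l <= i < (r n).+1)
    prob (P := P) [set o | u n < N (X o 0) /\ u n * (t / 2) < N (X o (j i))] <= 1) ->
  exists l, forall L, \sum_(l <= i < L) prob (P := Q) [set o | t <= N (Y o (j i))] <= 1.
Proof.
move=> hr t0 [l hl]; exists l => L.
pose phi (s : R) := (t - s) / (t / 2).
have t20 : 0 < t / 2 by rewrite divr_gt0.
have cphi : continuous phi.
  move=> s; apply: cvgM; last exact: cvg_cst.
  by apply: cvgB; [exact: cvg_cst|exact: cvg_id].
have /choice[a /choice[G haG]] := fun i => tail_coordinate_sandwich (j i) cphi.
apply: (@le_trans _ _ (\sum_(l <= i < L) G i)).
  apply: ler_sum => i _; have [_ _] := haG i; apply: le_trans.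
  rewrite le_eqVlt; apply/orP; left; apply/eqP; congr prob.
  apply/seteqP; split=> o /=; rewrite /phi pmulr_lle0 ?invr_gt0// subr_le0//.
have acv : \sum_(l <= i < L) a i n @[n --> \oo] --> \sum_(l <= i < L) G i.
  by apply: cvg_big => [|i _]; [exact: add_continuous|have [] := haG i].
apply: (cvgr_to_le acv); near=> n.
have Lr : (L <= (r n).+1)%N.
  by apply: leqW; near: n; move/cvgnyPge : hr; exact.
have hln : (w n)^-1 * \sum_(l <= i < (r n).+1)
    prob (P := P) [set o | u n < N (X o 0) /\ u n * (t / 2) < N (X o (j i))] <= 1.
  by near: n.
apply: le_trans hln; rewrite mulr_sumr.
have iw : 0 <= (w n)^-1 by rewrite invr_ge0 hw prob_ge0.
apply: (@le_trans _ _ (\sum_(l <= i < L) ((w n)^-1 *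
    prob (P := P) [set o | u n < N (X o 0) /\ u n * (t / 2) < N (X o (j i))]))).
  apply: ler_sum => i _; have [_ + _] := haG i; move=> /(_ n)/le_trans; apply.
  rewrite ler_wpM2l//; apply: le_prob.
  - exact: measurable_tail_coordinate.
  - exact: measurable_joint_exceedance.
  - move=> o [h1]; split => //; move: b; rewrite /phi/= ltr_pdivrMr// => b.
    by rewrite -ltr_pdivlMl//; lra.
have [lL|Ll] := leqP l L; last first.
  rewrite big_geq ?(ltnW Ll)//; apply: sumr_ge0 => i _.
  by rewrite mulr_ge0// prob_ge0.
rewrite (big_cat_nat lL Lr)/= lerDl; apply: sumr_ge0 => i _.
by rewrite mulr_ge0// prob_ge0.
Unshelve. all: by end_near. Qed.

Lemma tail_process_ell0 (r : nat -> nat) : r n @[n --> \oo] --> \oo ->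
  anticlustering N X 1 r u -> Q.-negligible [set o | ~ ell0 N (Y o)].
Proof.
move=> hr hS.
pose E p i := [set o | p.+1%:R^-1 <= N (Y o i%:Z)] `|` [set o | p.+1%:R^-1 <= N (Y o (- i%:Z))].
have mge j (t : R) : measurable [set o | t <= N (Y o j)].
  rewrite (_ : mkset _ = ~` [set o | N (Y o j) < t]).
    by apply: measurableC; exact: measurable_preimageY (measurable_norm_lt hN j t).
  by apply/seteqP; split=> o /=; rewrite leNgt => /negP.
have mE p i : measurable (E p i) by exact: measurableU.
have hE p : Q (lim_sup_set (E p)) = 0.
  apply: lim_sup_set_cvg0 => //.
  have t0 : 0 < p.+1%:R^-1 :> R by rewrite invr_gt0.
  have t20 : 0 < p.+1%:R^-1 / 2 :> R by rewrite divr_gt0.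
  have [l1 hl1] : exists l, forall L,
      \sum_(l <= i < L) prob (P := Q) [set o | p.+1%:R^-1 <= N (Y o i%:Z)] <= 1.
    apply: (@tail_process_summable r) => //.
    have [l hl] := anticlustering_tail hS ltr01 t20 ltr01.
    exists l.+1; move: hl; apply: filterS => n; apply: le_trans.
    rewrite ler_wpM2l ?invr_ge0 ?hw ?prob_ge0//.
    under [leRHS]eq_bigr do rewrite mulr1.
    by apply: sum_le_weighted_sum => i; exact: prob_ge0.
  have [l2 hl2] : exists l, forall L,
      \sum_(l <= i < L) prob (P := Q) [set o | p.+1%:R^-1 <= N (Y o (- i%:Z))] <= 1.
    apply: (@tail_process_summable r) => //.
    have [l hl] := anticlustering_tail hS t20 ltr01 ltr01.
    exists l.+1; move: hl; apply: filterS => n; apply: le_trans.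
    rewrite ler_wpM2l ?invr_ge0 ?hw ?prob_ge0//.
    under eq_bigr do rewrite prob_joint_exceedance_opp.
    under [leRHS]eq_bigr do rewrite mulr1.
    by apply: sum_le_weighted_sum => i; exact: prob_ge0.
  apply: (@le_lt_trans _ _ ((maxn l1 l2)%:R + (1 + 1))%:E); last by rewrite ltry.
  apply: lime_le; first by apply: is_cvg_nneseries => i _ _; exact: measure_ge0.
  near=> L.
  have lL : (maxn l1 l2 <= L)%N by near: L; exact: nbhs_infty_ge.
  rewrite (eq_bigr (fun i => (prob (P := Q) (E p i))%:E)); last first.
    by move=> i _; rewrite /prob fineK// fin_num_measure.
  rewrite sumEFin lee_fin (big_cat_nat _ (n := maxn l1 l2))//=; apply: lerD.
    rewrite (le_trans (ler_sum _ (G := fun=> 1) _))//.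
      by move=> i _; rewrite -lee_fin /prob fineK ?fin_num_measure// probability_le1.
    by rewrite big_const_nat subn0 iter_addr_0.
  apply: (@le_trans _ _ (\sum_(maxn l1 l2 <= i < L)
      prob (P := Q) [set o | p.+1%:R^-1 <= N (Y o i%:Z)] +
      \sum_(maxn l1 l2 <= i < L)
      prob (P := Q) [set o | p.+1%:R^-1 <= N (Y o (- i%:Z))])).
    rewrite -big_split/=; apply: ler_sum => i _.
    rewrite -lee_fin EFinD /prob !fineK ?fin_num_measure//.
    by apply: measureU2.
  apply: lerD.
    apply: le_trans (hl1 L); rewrite [leRHS](big_cat_nat _ (n := maxn l1 l2))//= ?leq_maxl// lerDr.
    by apply: sumr_ge0 => i _; exact: prob_ge0.
  apply: le_trans (hl2 L); rewrite [leRHS](big_cat_nat _ (n := maxn l1 l2))//= ?leq_maxr// lerDr.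
  by apply: sumr_ge0 => i _; exact: prob_ge0.
have nE : Q.-negligible (\bigcup_p lim_sup_set (E p)).
  apply: negligible_bigcup => p; exists (lim_sup_set (E p)); split; [|exact: hE|by []].
  by apply: bigcapT_measurable => n; apply: bigcup_measurable.
apply: negligibleS nE => o /= ho; apply: contrapT => hn; apply: ho.
rewrite ell0E => p _.
have : ~ lim_sup_set (E p) o by move=> h; apply: hn; exists p.
move=> /existsNP[m /not_implyP[_ hm]]; exists m => // j _ mj.
rewrite ltNge; apply/negP => hj; apply: hm; exists (absz j) => //.
have [j0|j0] := leP 0 j; [left|right]; rewrite /=.
  by rewrite gez0_abs.
by rewrite ltz0_abs// opprK.
Unshelve. all: by end_near. Qed.

End tail_process_regularity.

(** * Anchored means *)

Section equality_of_laws.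
Context {R : realType} {d1 d2 d3 : measure_display}
  {T1 : measurableType d1} {T2 : measurableType d2} {S : measurableType d3}.
Variables (mu1 : {measure set T1 -> \bar R}) (mu2 : {measure set T2 -> \bar R}).

Lemma ge0_integral_eq_law (f1 : T1 -> S) (f2 : T2 -> S) (g : S -> \bar R) :
  measurable_fun setT f1 -> measurable_fun setT f2 ->
  (forall A, measurable A -> mu1 (f1 @^-1` A) = mu2 (f2 @^-1` A)) ->
  measurable_fun setT g -> (forall x, (0 <= g x)%E) ->
  (\int[mu1]_x g (f1 x) = \int[mu2]_x g (f2 x))%E.
Proof.
move=> mf1 mf2 law mg g0.
pose F1 : {mfun T1 >-> S} := HB.pack f1 (isMeasurableFun.Build _ _ _ _ _ mf1).
pose F2 : {mfun T2 >-> S} := HB.pack f2 (isMeasurableFun.Build _ _ _ _ _ mf2).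
have := ge0_integral_pushforward mf1 mu1 measurableT mg (fun x _ => g0 x).
rewrite preimage_setT => <-.
have := ge0_integral_pushforward mf2 mu2 measurableT mg (fun x _ => g0 x).
rewrite preimage_setT => <-.
apply: (@eq_measure_integral _ _ _ _ (pushforward mu2 F2) (pushforward mu1 F1)).
by move=> A mA _; exact: law.
Qed.

End equality_of_laws.

Section window_limits.
Context {R : realType} {d : nat} (N : 'rV[R]_d -> R) (hN : is_norm N).
Notation path := (pathspace R d).
Context {dX : measure_display} {Omega : measurableType dX}
  {P : probability Omega R} (X : {RV P >-> path}).
Context {dY : measure_display} {OmegaY : measurableType dY}
  {Q : probability OmegaY R} (Y : {RV Q >-> path}).
Context (alpha : R) (hX : stationary X) (hindex : tail_index N X alpha).
Context (hY : tail_process N X Y) (u : nat -> R) (w : nat -> R)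
  (hw : forall n, w n = prob (P := P) (exceedance N X (u n)))
  (hu0 : forall n, 0 < u n)
  (hu : u n @[n --> \oo] --> +oo).
Context (r : nat -> nat) (hr : r n @[n --> \oo] --> \oo)
  (hS : anticlustering N X 1 r u)
  (hS2 : anticlustering N X 1 (fun n => (2 * r n)%N) u).
Context (H : path -> R) (hH : cluster_functional N Y H).
Context (M : R) (M0 : 0 <= M) (HM : forall x, ell0 N x -> H x <= M).

Lemma anchored_fun_bounded k x : `|anchored_fun N H k x| <= M.
Proof.
rewrite ger0_norm ?(anchored_fun_ge0 hH)//.
apply: le_trans (anchored_fun_le k x HM M0) _; rewrite indicE.
by case: (_ \in _); rewrite ?mulr1// mulr0.
Qed.

Lemma restrict_scale_path a A (x : path) :
  scale_path a (restrict_path A x) = restrict_path A (scale_path a x).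
Proof.
apply/funext => j; rewrite /scale_path /restrict_path /patch.
by case: ifP => //; rewrite scaler0.
Qed.

Lemma measurable_scaled_window n a b :
  measurable_fun setT (fun o => restrict_path (int_segment a b) (scale_path (u n)^-1 (X o))).
Proof.
apply: (measurableT_comp (measurable_restrict_path _)).
by apply: (measurableT_comp (measurable_scale_path _)); exact: measurable_funPT.
Qed.

Lemma scaled_norm_gt1 n (x : path) j :
  (1 < N (scale_path (u n)^-1 x j)) = (u n < N (x j)).
Proof.
rewrite /scale_path (norm_scale hN) gtr0_norm ?invr_gt0//.
by rewrite ltr_pdivlMl// mulr1.
Qed.

Lemma anchored_fun_restrict_dist k m a b (x : path) :
  a <= - m%:Z -> m%:Z <= b ->
  `|anchored_fun N H k (restrict_path (int_segment a b) x) -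
    anchored_fun N H k (restrict_path (int_segment (- m%:Z) m%:Z) x)| <=
  M * \1_[set x : path | 1 < N (x 0) /\ exists j : int,
          [/\ int_segment a b j, (m < `|j|)%N & 1 < N (x j)]] x.
Proof.
move=> am mb; set D := mkset _.
have ell A B y : ell0 N (restrict_path (int_segment A B) y) by exact: ell0_restrict_segment.
have [xD|xD] := pselect (D x).
  rewrite indicE mem_set// mulr1.
  have := anchored_fun_bounded k (restrict_path (int_segment a b) x).
  have := anchored_fun_bounded k (restrict_path (int_segment (- m%:Z) m%:Z) x).
  have := anchored_fun_ge0 hH k (restrict_path (int_segment a b) x).
  have := anchored_fun_ge0 hH k (restrict_path (int_segment (- m%:Z) m%:Z) x).
  by rewrite !ler_norml => ? ? /andP[? ?] /andP[? ?]; apply/andP; split; lra.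
rewrite indicE memNset// mulr0 normr_le0 subr_eq0; apply/eqP.
have rE A B j : int_segment A B j -> restrict_path (int_segment A B) x j = x j.
  by move=> h; rewrite /restrict_path patchT// inE.
have rN A B j : ~ int_segment A B j -> restrict_path (int_segment A B) x j = 0.
  by move=> h; rewrite /restrict_path /patch ifF//; apply/negbTE/negP; rewrite inE.
have sub j : int_segment (- m%:Z) m%:Z j -> int_segment a b j.
  by rewrite /int_segment/=; lia.
have [x0|x0] := boolP (1 < N (x 0)); last first.
  have aux A B : int_segment A B 0 -> anchored_fun N H k (restrict_path (int_segment A B) x) = 0.
    move=> h; rewrite /anchored_fun /patch ifF//; apply/negbTE/negP.
    by rewrite inE => -[_ []]; rewrite rE// (negbTE x0).
  by rewrite !aux// /int_segment/=; lia.
have ex j : int_segment a b j -> 1 < N (x j) -> int_segment (- m%:Z) m%:Z j.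
  move=> jab xj; rewrite /int_segment/=; apply: contrapT => hj; apply: xD; split => //.
  by exists j; split => //; lia.
have exc j : (1 < N (restrict_path (int_segment a b) x j)) =
    (1 < N (restrict_path (int_segment (- m%:Z) m%:Z) x j)).
  have [hj|hj] := pselect (int_segment (- m%:Z) m%:Z j); first by rewrite !rE//; exact: sub.
  rewrite (rN _ _ _ hj) (is_norm0 hN) ltr10.
  have [hj'|hj'] := pselect (int_segment a b j); last by rewrite rN// (is_norm0 hN) ltr10.
  by rewrite rE//; apply/negbTE/negP => /(ex _ hj')/hj.
apply: (anchored_fun_eq hH k (ell _ _ _) (ell _ _ _) exc).
  by move=> j; rewrite exc; exact: (exceedances_in_restrict hN).
by move=> j hj; rewrite !rE//; exact: sub.
Qed.

Definition joint_exceedance n i : R :=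
  prob (P := P) [set o | u n < N (X o 0) /\ u n < N (X o i%:Z)].

Lemma joint_exceedance_ge0 n i : 0 <= joint_exceedance n i.
Proof. exact: prob_ge0. Qed.

Lemma joint_exceedance_tail e : 0 < e ->
  exists l, \forall n \near \oo, (w n)^-1 * \sum_(l <= i < (2 * r n).+1)
    (i%:R * joint_exceedance n i) <= e.
Proof.
move=> e0; have [l hl] := anticlustering_tail hw hS2 ltr01 ltr01 e0.
by exists l; move: hl; apply: filterS => n; rewrite /joint_exceedance mulr1.
Qed.

Lemma measurable_far_exceedance n m a b :
  measurable [set o | u n < N (X o 0) /\ exists j : int,
          [/\ int_segment a b j, (m < `|j|)%N & u n < N (X o j)]].
Proof.
rewrite (_ : mkset _ = \bigcup_(j in [set j : int | int_segment a b j /\ (m < `|j|)%N])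
  [set o | u n < N (X o 0) /\ u n < N (X o j)]).
  rewrite bigcup_mkcond; apply: (@countable_bigcupT_measurable _ _ int) => // j.
  by case: ifP => // _; exact: measurable_joint_exceedance.
apply/seteqP; split=> o /=; first by move=> [h [j [h1 h2 h3]]]; exists j.
by move=> [j [h1 h2] [h3 h4]]; split => //; exists j.
Qed.

Lemma prob_far_exceedance n m a b : - (2 * r n)%N%:Z <= a -> b <= (2 * r n)%N%:Z ->
  prob (P := P) [set o | u n < N (X o 0) /\ exists j : int,
          [/\ int_segment a b j, (m < `|j|)%N & u n < N (X o j)]] <=
  2 * \sum_(m.+1 <= i < (2 * r n).+1) joint_exceedance n i.
Proof.
move=> ha hb.
pose F i := [set o | u n < N (X o 0) /\ u n < N (X o i%:Z)] `|`
            [set o | u n < N (X o 0) /\ u n < N (X o (- i%:Z))].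
have mJ (j : int) : measurable [set o | u n < N (X o 0) /\ u n < N (X o j)].
  exact: measurable_joint_exceedance.
have mF i : measurable (F i) by exact: measurableU.
apply: (@le_trans _ _ (\sum_(m.+1 <= i < (2 * r n).+1) prob (P := P) (F i))); last first.
  rewrite mulr_sumr; apply: ler_sum => i _.
  apply: (@le_trans _ _ (joint_exceedance n i + prob (P := P)
      [set o | u n < N (X o 0) /\ u n < N (X o (- i%:Z))])).
    rewrite -lee_fin EFinD /joint_exceedance /prob !fineK ?fin_num_measure//.
    exact: measureU2.
  rewrite (prob_joint_exceedance_opp hN hX).
  rewrite (_ : [set o | _] = [set o | u n < N (X o 0) /\ u n < N (X o i%:Z)])//.
  by rewrite mulr_natl mulr2n.
apply: prob_bigcup_le => //.
  exact: measurable_far_exceedance.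
move=> o [h0 [j [jab mj hj]]]; exists (absz j).
  by rewrite mem_index_iota; move: jab; rewrite /int_segment/=; lia.
have [j0|j0] := leP 0 j; [left|right]; split => //.
  by rewrite gez0_abs.
by rewrite ltz0_abs// opprK.
Qed.

Definition anchored_mean n k a b : R := \int[P]_o anchored_fun N H k
  (restrict_path (int_segment a b) (scale_path (u n)^-1 (X o))).

Lemma integrable_anchored_window n k a b : P.-integrable setT (EFin \o
  (fun o => anchored_fun N H k (restrict_path (int_segment a b) (scale_path (u n)^-1 (X o))))).
Proof.
apply: (@bounded_integrable _ _ _ _ _ M).
  exact: (measurableT_comp (measurable_anchored_fun hN hH k) (measurable_scaled_window n a b)).
by move=> o; exact: anchored_fun_bounded.
Qed.

Lemma anchored_window_dist e : 0 < e -> exists m0, forall m, (m0 <= m)%N ->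
  \forall n \near \oo, forall k a b, a <= - m%:Z -> m%:Z <= b ->
    - (2 * r n)%N%:Z <= a -> b <= (2 * r n)%N%:Z ->
    `|(w n)^-1 * anchored_mean n k a b - (w n)^-1 * anchored_mean n k (- m%:Z) m%:Z| <= e.
Proof.
move=> e0; have M1 : 0 < 2 * M + 1 by rewrite ltr_wpDl// mulr_ge0.
have [l hl] := joint_exceedance_tail (divr_gt0 e0 M1).
exists l => m lm; move: hl; apply: filterS => n hn k a b am mb ha hb.
have iw : 0 <= (w n)^-1 by rewrite invr_ge0 hw prob_ge0.
rewrite -mulrBr normrM (ger0_norm iw) /anchored_mean -RintegralB//;
  [|exact: integrable_anchored_window..].
set D : set Omega := [set o | u n < N (X o 0) /\ exists j : int,
          [/\ int_segment a b j, (m < `|j|)%N & u n < N (X o j)]].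
have mD : measurable D by exact: measurable_far_exceedance.
have hD : `|\int[P]_o (anchored_fun N H k (restrict_path (int_segment a b) (scale_path (u n)^-1 (X o))) -
   anchored_fun N H k (restrict_path (int_segment (- m%:Z) m%:Z) (scale_path (u n)^-1 (X o))))|
   <= M * prob (P := P) D.
  rewrite -Rintegral_cst_indic//.
  have iD : P.-integrable setT (EFin \o (fun o => anchored_fun N H k (restrict_path (int_segment a b) (scale_path (u n)^-1 (X o))) -
   anchored_fun N H k (restrict_path (int_segment (- m%:Z) m%:Z) (scale_path (u n)^-1 (X o))))).
    exact: (integrableB measurableT (integrable_anchored_window n k a b)
      (integrable_anchored_window n k (- m%:Z) m%:Z)).
  apply: (le_trans (le_normr_Rintegral _ iD)) => //.
  apply: le_Rintegral => //.
  - exact: integrable_norm iD.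
  - apply: (@bounded_integrable _ _ _ _ _ M).
      by apply: measurable_funM => //; exact: measurable_indic.
    by move=> o; rewrite indicE normrM (ger0_norm M0); case: (_ \in _); rewrite ?normr1 ?mulr1// normr0 mulr0.
  - move=> o _; have := anchored_fun_restrict_dist k (scale_path (u n)^-1 (X o)) am mb.
    rewrite !indicE; congr (_ <= _ * (nat_of_bool _)%:R).
    apply/idP/idP; rewrite !inE/= /D/= scaled_norm_gt1 => -[h [j [h1 h2]]].
      by rewrite scaled_norm_gt1 => h3; split => //; exists j.
    by move=> h3; split => //; exists j; rewrite scaled_norm_gt1.
have h2 := prob_far_exceedance m ha hb.
have h3 : \sum_(m.+1 <= i < (2 * r n).+1) joint_exceedance n i <=
   \sum_(l <= i < (2 * r n).+1) i%:R * joint_exceedance n i.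
  apply: le_trans (sum_le_weighted_sum l (2 * r n).+1 (joint_exceedance_ge0 n)).
  have [h|h] := leqP m.+1 (2 * r n).+1; last first.
    rewrite big_geq ?(ltnW h)//; apply: sumr_ge0 => i _; exact: joint_exceedance_ge0.
  rewrite [leRHS](big_cat_nat _ (n := m.+1))//= lerDr.
  by apply: sumr_ge0 => i _; exact: joint_exceedance_ge0.
set S := \sum_(l <= i < _) _ in hn h3.
apply: (@le_trans _ _ ((2 * M + 1) * ((w n)^-1 * S))); last first.
  by rewrite mulrC -ler_pdivlMr.
have S0 : 0 <= S by apply: sumr_ge0 => i _; rewrite mulr_ge0// joint_exceedance_ge0.
rewrite mulrCA ler_wpM2l//; apply: (le_trans hD).
apply: (@le_trans _ _ (M * (2 * S))); last by rewrite mulrA mulrDl (mulrC M) lerDl mul1r.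
by rewrite ler_wpM2l// (le_trans h2)// ler_pM2l.
Qed.

Lemma measurable_exceedances_in a b : measurable (@exceedances_in R d N a b).
Proof.
rewrite (_ : exceedances_in N a b = \bigcap_(j in [set j : int | ~ int_segment a b j])
    [set x : path | N (x j) <= 1]).
  rewrite bigcap_mkcond; apply: (@countable_bigcapT_measurable _ _ int) => j.
  by case: ifP => // _; exact: measurable_norm_le.
apply/seteqP; split=> x /= h j; last first.
  by move=> xj; apply: contrapT => /(h j)/=; rewrite leNgt xj.
by move=> jab; rewrite /= leNgt; apply/negP => /h.
Qed.

Lemma continuity_windows : exists B : nat -> set OmegaY,
  [/\ forall m, measurable (B m),
      forall m o, B m o -> [/\ ell0 N (Y o), forall j, N (Y o j) != 1,
        exceedances_in N (- m%:Z) m%:Z (Y o) & ell0_continuous_at N H (Y o)] &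
      forall e, 0 < e -> exists m0, forall m, (m0 <= m)%N ->
        prob (P := Q) (~` B m) <= e].
Proof.
have n1 := tail_process_ell0 hN hX hY hw hu0 hu hr hS.
have mN1 j : measurable [set o | N (Y o j) = 1].
  rewrite (_ : mkset _ = [set o | N (Y o j) <= 1] `\` [set o | N (Y o j) < 1]).
    apply: measurableD; first exact: measurable_preimageY (measurable_norm_le hN j 1).
    exact: measurable_preimageY (measurable_norm_lt hN j 1).
  apply/seteqP; split=> o /=; first by move=> ->; rewrite lexx ltxx.
  by move=> [h1 h2]; apply/eqP; rewrite eq_le h1 leNgt; apply/negP.
have n2 : Q.-negligible (\bigcup_n ([set o | N (Y o n%:Z) = 1] `|` [set o | N (Y o (- n%:Z)) = 1])).
  have aux j : Q.-negligible [set o | N (Y o j) = 1].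
    exists [set o | N (Y o j) = 1]; split => //.
    have := tail_process_not_one hN hX hindex hY hw hu0 hu j.
    by rewrite /prob => /eqP; rewrite fine_eq0 ?fin_num_measure// => /eqP.
  by apply: negligible_bigcup => n; apply: negligibleU; exact: aux.
have n3 := cf_continuous hH.
have [A [mA QA hA]] := negligibleU n1 (negligibleU n2 n3).
have good o : ~ A o -> [/\ ell0 N (Y o), forall j, N (Y o j) != 1 & ell0_continuous_at N H (Y o)].
  move=> nA; have l0 : ell0 N (Y o) by apply: contrapT => h; apply: nA; apply: hA; left.
  split => //.
    move=> j; apply/eqP => h; apply: nA; apply: hA; right; left.
    exists (absz j) => //; have [j0|j0] := leP 0 j; [left|right]; rewrite /=.
      by rewrite gez0_abs.
    by rewrite ltz0_abs// opprK.
  by apply: contrapT => h; apply: nA; apply: hA; right; right; rewrite /= => /(_ l0).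
exists (fun m => ~` A `&` [set o | exceedances_in N (- m%:Z) m%:Z (Y o)]).
have mB m : measurable (~` A `&` [set o | exceedances_in N (- m%:Z) m%:Z (Y o)]).
  apply: measurableI; first exact: measurableC.
  exact: measurable_preimageY (measurable_exceedances_in _ _).
split => //; first by move=> m o [/good[h1 h2 h3] h4].
move=> e e0.
have : Q (~` A `&` [set o | exceedances_in N (- m%:Z) m%:Z (Y o)]) @[m --> \oo] --> 1%E.
  rewrite (_ : 1%E = Q (\bigcup_m (~` A `&` [set o | exceedances_in N (- m%:Z) m%:Z (Y o)]))).
    apply: (@nondecreasing_cvg_mu _ _ _ Q
      (fun m => ~` A `&` [set o | exceedances_in N (- m%:Z) m%:Z (Y o)])) => //.
      exact: bigcupT_measurable.
    move=> m1 m2 m12; apply/subsetPset => o [h1 h2]; split => // j /h2.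
    by rewrite /int_segment/=; lia.
  rewrite (_ : \bigcup_m _ = ~` A); first by rewrite probability_setC ?QA ?sube0.
  apply/seteqP; split=> o; first by case=> m _ [].
  move=> nA; have [h1 _ _] := good o nA.
  have [m hm] := h1 1 ltr01; exists m => //; split => // j xj.
  have : (`|j| < m)%N by rewrite ltnNge; apply/negP => /hm; rewrite ltNge (ltW xj).
  by rewrite /int_segment/=; lia.
move=> /fine_cvg /(cvgr_ge _) /(_ (1 - e)); rewrite ltrBlDr ltrDl => /(_ e0)[m0 _ hm0].
exists m0 => m /hm0/= h; rewrite /prob probability_setC// fineB ?fin_num_measure//.
by rewrite lerBlDr -lerBlDl.
Qed.

Lemma anchored_window_limsup k : exists B : nat -> set OmegaY,
  (forall e, 0 < e -> exists m0, forall m, (m0 <= m)%N -> prob (P := Q) (~` B m) <= e) /\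
  forall m e, 0 < e -> \forall n \near \oo,
    `|(w n)^-1 * anchored_mean n k (- m%:Z) m%:Z - \int[Q]_o anchored_fun N H k (Y o)|
      <= (M + M) * prob (P := Q) (~` B m) + e.
Proof.
have [B [mB hB cvB]] := continuity_windows.
exists B; split => // m e e0.
pose f (v : 'M[R]_((2 * m).+1, d)) := anchored_fun N H k (pad v).
have fE x : f (window (- m%:Z) (2 * m) x) =
    anchored_fun N H k (restrict_path (int_segment (- m%:Z) m%:Z) x).
  by rewrite /f pad_window.
have mY : measurable_fun setT Y by exact: measurable_funPT.
have fB o : B m o -> f (window (- m%:Z) (2 * m) (Y o)) = anchored_fun N H k (Y o).
  move=> /hB[h1 _ h3 _]; rewrite fE; apply/esym.
  have xE j : (1 < N (Y o j)) = (1 < N (restrict_path (int_segment (- m%:Z) m%:Z) (Y o) j)).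
    rewrite /restrict_path /patch; case: ifPn => // hj.
    rewrite (is_norm0 hN) ltr10; apply/negbTE/negP => /h3 h.
    by move: hj; rewrite mem_set.
  apply: (anchored_fun_eq hH k h1 (ell0_restrict_segment hN _ _ _) xE h3).
  by move=> j hj; rewrite /restrict_path patchT// inE.
have cfB o : B m o -> forall e, 0 < e -> exists2 del : R, 0 < del &
     forall v, `|v - window (- m%:Z) (2 * m) (Y o)| < del ->
       `|f v - f (window (- m%:Z) (2 * m) (Y o))| < e.
  move=> Bo e' e'0; rewrite fB//; have [h1 h2 h3 h4] := hB _ _ Bo.
  exact: (anchored_fun_window_continuous hN hH k h1 h2 h3 h4 e'0).
have EE n : \int[P]_o (f (window (- m%:Z) (2 * m) (scale_path (u n)^-1 (X o)))
                        * \1_(exceedance N X (u n)) o) = anchored_mean n k (- m%:Z) m%:Z.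
  apply: eq_Rintegral => o _; rewrite fE indicE.
  have [h|h] := boolP (o \in _); first by rewrite mulr1.
  rewrite mulr0 /anchored_fun /patch ifF//; apply/negbTE/negP; rewrite inE => -[_ []].
  rewrite /restrict_path patchT; last by rewrite inE /int_segment/=; lia.
  by rewrite scaled_norm_gt1 => h' _; move: h; rewrite mem_set.
have mf n : measurable_fun setT (fun o => f (window (- m%:Z) (2 * m) (scale_path (u n)^-1 (X o)))).
  under eq_fun do rewrite fE.
  exact: (measurableT_comp (measurable_anchored_fun hN hH k) (measurable_scaled_window n _ _)).
have mG : measurable_fun setT (fun o => anchored_fun N H k (Y o)).
  exact: (measurableT_comp (measurable_anchored_fun hN hH k) mY).
have up := tail_process_limsup hN hY hw hu (fun v => anchored_fun_bounded k (pad v))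
  mf (mB m) mG (fun o => anchored_fun_bounded k (Y o)) fB cfB e0.
have dn := @tail_process_limsup _ _ _ hN _ _ _ X _ _ _ Y hY u w hw hu (- m%:Z) (2 * m)
  (fun v => - f v) M (B m) (fun o => - anchored_fun N H k (Y o)) _ _ (mB m) _ _ _ _ e e0.
have {dn} dn := dn ltac:(by move=> v; rewrite normrN; exact: anchored_fun_bounded)
  ltac:(by move=> n; apply: measurable_funN; exact: mf)
  ltac:(exact: measurable_funN mG)
  ltac:(by move=> v; rewrite normrN; exact: anchored_fun_bounded)
  ltac:(by move=> o /fB <-)
  ltac:(move=> o Bo e' e'0; have [del del0 h] := cfB o Bo e' e'0; exists del => // v /h;
    by rewrite /= -opprD normrN).
have NI dT (T : measurableType dT) (mu : probability T R) (g : T -> R) :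
    mu.-integrable setT (EFin \o g) -> \int[mu]_x (- g x) = - \int[mu]_x g x.
  move=> ig; rewrite -mulN1r -RintegralZl//.
  by apply: eq_Rintegral => x _; rewrite mulN1r.
have EN n : \int[P]_o (- f (window (- m%:Z) (2 * m) (scale_path (u n)^-1 (X o)))
                        * \1_(exceedance N X (u n)) o) = - anchored_mean n k (- m%:Z) m%:Z.
  rewrite -EE -NI; first by apply: eq_Rintegral => o _; rewrite mulNr.
  apply: (@bounded_integrable _ _ _ _ _ M).
    apply: measurable_funM => //; apply: measurable_indic; exact: measurable_exceedance.
  move=> o; rewrite normrM indicE; case: (o \in _); last by rewrite normr0 mulr0.
  by rewrite normr1 mulr1; exact: anchored_fun_bounded.
have iG := bounded_integrable Q mG (fun o => anchored_fun_bounded k (Y o)).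
near=> n.
have upn : (w n)^-1 * anchored_mean n k (- m%:Z) m%:Z <=
    \int[Q]_o anchored_fun N H k (Y o) + (M + M) * prob (P := Q) (~` B m) + e.
  by near: n; move: up; apply: filterS => n; rewrite EE.
have dnn : - ((w n)^-1 * anchored_mean n k (- m%:Z) m%:Z) <=
    - (\int[Q]_o anchored_fun N H k (Y o)) + (M + M) * prob (P := Q) (~` B m) + e.
  by near: n; move: dn; apply: filterS => n; rewrite NI// EN mulrN.
by rewrite ler_norml; apply/andP; split; lra.
Unshelve. all: by end_near. Qed.

Lemma anchored_fun_limit k (a b : nat -> int) :
  (\forall n \near \oo, - (2 * r n)%N%:Z <= a n /\ b n <= (2 * r n)%N%:Z) ->
  (forall m : nat, \forall n \near \oo, a n <= - m%:Z /\ m%:Z <= b n) ->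
  (w n)^-1 * anchored_mean n k (a n) (b n) @[n --> \oo] --> \int[Q]_o anchored_fun N H k (Y o).
Proof.
move=> hr2 hab; apply/cvgrPdist_le => e e0.
have e30 : 0 < e / 3 by rewrite divr_gt0.
have M1 : 0 < M + M + 1 by rewrite ltr_wpDl// addr_ge0.
have [m1 hm1] := anchored_window_dist e30.
have [B [hB hB']] := anchored_window_limsup k.
have [m2 hm2] := hB (e / 3 / (M + M + 1)) ltac:(by rewrite divr_gt0).
pose m := maxn m1 m2.
have h1 := hm1 m (leq_maxl _ _); have h2 := hm2 m (leq_maxr _ _).
near=> n.
have [ha hb] : - (2 * r n)%N%:Z <= a n /\ b n <= (2 * r n)%N%:Z by near: n.
have [am mb] : a n <= - m%:Z /\ m%:Z <= b n by near: n; exact: hab.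
have h3 : `|(w n)^-1 * anchored_mean n k (a n) (b n) - (w n)^-1 * anchored_mean n k (- m%:Z) m%:Z| <= e / 3.
  by have : forall k a b, a <= - m%:Z -> m%:Z <= b ->
    - (2 * r n)%N%:Z <= a -> b <= (2 * r n)%N%:Z ->
    `|(w n)^-1 * anchored_mean n k a b - (w n)^-1 * anchored_mean n k (- m%:Z) m%:Z| <= e / 3;
    [near: n; exact: h1|apply].
have h4 : `|(w n)^-1 * anchored_mean n k (- m%:Z) m%:Z - \int[Q]_o anchored_fun N H k (Y o)|
      <= (M + M) * prob (P := Q) (~` B m) + e / 3 by near: n; exact: hB'.
have h5 : (M + M) * prob (P := Q) (~` B m) <= e / 3.
  apply: (@le_trans _ _ ((M + M) * (e / 3 / (M + M + 1)))).
    by rewrite ler_wpM2l// addr_ge0.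
  rewrite mulrCA ger_pMr// ler_pdivrMr// mul1r; lra.
rewrite distrC -(subrKA ((w n)^-1 * anchored_mean n k (- m%:Z) m%:Z)).
apply: (le_trans (ler_normD _ _)); lra.
Unshelve. all: by end_near. Qed.

Lemma anchored_fun_tail e : 0 < e -> exists K, \forall n \near \oo,
  forall a b : nat -> int, (forall k, (k < r n)%N -> b k <= (2 * r n)%N%:Z) ->
  \sum_(K <= k < r n) (w n)^-1 * anchored_mean n k (a k) (b k) <= e.
Proof.
move=> e0; have M1 : 0 < M + 1 by rewrite ltr_wpDl.
have [K hK] := joint_exceedance_tail (divr_gt0 e0 M1).
exists K; move: hK; apply: filterS => n hn a b hb.
have iw : 0 <= (w n)^-1 by rewrite invr_ge0 hw prob_ge0.
have J0 := joint_exceedance_ge0 n.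
have h1 k : (k < r n)%N -> anchored_mean n k (a k) (b k) <=
    M * \sum_(k.+1 <= i < (2 * r n).+1) joint_exceedance n i.
  move=> kr; set D := \bigcup_(i in [set i | (k < i < (2 * r n).+1)%N])
    [set o | u n < N (X o 0) /\ u n < N (X o i%:Z)].
  have mD : measurable D.
    by apply: bigcup_measurable => i _; exact: measurable_joint_exceedance.
  apply: (@le_trans _ _ (M * prob (P := P) D)); last first.
    rewrite ler_wpM2l//; apply: prob_bigcup_le => //.
      by move=> i; exact: measurable_joint_exceedance.
    by move=> o [i /= ki hi]; exists i => //; rewrite mem_index_iota.
  rewrite -Rintegral_cst_indic//; apply: le_Rintegral => //.
  - exact: integrable_anchored_window.
  - apply: (@bounded_integrable _ _ _ _ _ M).
      by apply: measurable_funM => //; exact: measurable_indic.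
    by move=> o; rewrite indicE normrM (ger0_norm M0); case: (_ \in _);
      rewrite ?normr1 ?mulr1// normr0 mulr0.
  move=> o _; apply: le_trans (anchored_fun_le k _ HM M0) _.
  rewrite ler_wpM2l// !indicE; case: (boolP (_ \in spread N k `&` _)) => // h.
  rewrite mem_set//; move: h; rewrite inE => -[[i [j [ij xi xj]]] [x0 past]].
  have rE l : 1 < N (restrict_path (int_segment (a k) (b k)) (scale_path (u n)^-1 (X o)) l) ->
      int_segment (a k) (b k) l /\ u n < N (X o l).
    rewrite /restrict_path /patch; case: ifPn; last by rewrite (is_norm0 hN) ltr10.
    by rewrite inE scaled_norm_gt1.
  have i0 : 0 <= i by rewrite leNgt; apply/negP => /past; rewrite leNgt xi.
  have [_ x0'] := rE _ x0; have [jab xj'] := rE _ xj.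
  have := hb k kr; move: jab; rewrite /int_segment/= => /andP[_ jb] b2.
  have kj : (k < absz j < (2 * r n).+1)%N by move: i0 ij jb b2; clear; lia.
  have j0 : 0 <= j by move: i0 ij; clear; lia.
  by exists (absz j); rewrite //= gez0_abs.
apply: (@le_trans _ _ ((w n)^-1 * (M * \sum_(K <= k < r n)
    \sum_(k.+1 <= i < (2 * r n).+1) joint_exceedance n i))).
  rewrite -mulr_sumr ler_wpM2l// mulr_sumr !big_nat; apply: ler_sum => k /andP[_ kr].
  exact: h1.
set b2 := (2 * r n).+1 in hn *.
have h2 : \sum_(K <= k < r n) \sum_(k.+1 <= i < b2) joint_exceedance n i <=
    \sum_(K <= i < b2) i%:R * joint_exceedance n i.
  apply: (@le_trans _ _ (\sum_(K <= k < r n) \sum_(K <= i < b2 | (k < i)%N) joint_exceedance n i)).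
    rewrite !big_nat; apply: ler_sum => k /andP[Kk _].
    by rewrite (@big_nat_widenl _ _ _ k.+1 K)// leqW.
  rewrite (exchange_big_dep xpredT)//=; apply: ler_sum => i _.
  rewrite big_const_seq iter_addr_0 mulr_natl ler_wpMn2l// -size_filter.
  rewrite -[leqRHS](size_iota 0 i); apply: uniq_leq_size.
    by rewrite filter_uniq// iota_uniq.
  by move=> k; rewrite mem_filter mem_iota add0n => /andP[].
set S := \sum_(K <= i < b2) _ in hn h2.
have S0 : 0 <= S by apply: sumr_ge0 => i _; rewrite mulr_ge0.
apply: (@le_trans _ _ ((M + 1) * ((w n)^-1 * S))); last first.
  by rewrite mulrC -ler_pdivlMr.
rewrite [leRHS]mulrCA ler_wpM2l// (le_trans (ler_wpM2l M0 h2))// ler_wpM2r// lerDl//.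
Qed.

End window_limits.

(** * Summation and the conditioned law *)

Section tail_series.
Context {R : realType}.

Lemma tail_series_cvg (g : nat -> nat -> R) (G : nat -> R) (r : nat -> nat) :
  (forall n k, 0 <= g n k) -> (forall k, g n k @[n --> \oo] --> G k) ->
  r n @[n --> \oo] --> \oo ->
  (forall e, 0 < e -> exists K, \forall n \near \oo, \sum_(K <= k < r n) g n k <= e) ->
  exists S : R, \sum_(0 <= k < r n) g n k @[n --> \oo] --> S /\
    (\sum_(0 <= k <oo) (G k)%:E = S%:E)%E.
Proof.
move=> g0 gG hr tail.
have G0 k : 0 <= G k by apply: (cvgr_to_ge (gG k)); apply: nearW => n; exact: g0.
have sumG a b : \sum_(a <= k < b) g n k @[n --> \oo] --> \sum_(a <= k < b) G k.
  by apply: cvg_big => [|i _]; [exact: add_continuous|exact: gG].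
have tailG e K : (\forall n \near \oo, \sum_(K <= k < r n) g n k <= e) ->
    forall L, \sum_(K <= k < L) G k <= e.
  move=> hK L; apply: (cvgr_to_le (sumG K L)); near=> n.
  have h : \sum_(K <= k < r n) g n k <= e by near: n.
  have Lr : (L <= r n)%N by near: n; move/cvgnyPge : hr; exact.
  apply: le_trans h; have [KL|LK] := leqP K L; last first.
    by rewrite big_geq ?(ltnW LK)//; apply: sumr_ge0.
  by rewrite [leRHS](big_cat_nat KL Lr)/= lerDl; apply: sumr_ge0.
pose s n := \sum_(0 <= k < n) G k.
have snd : nondecreasing_seq s.
  move=> a b ab; rewrite /s [leRHS](big_cat_nat (leq0n a) ab)/= lerDl.
  exact: sumr_ge0.
have [K1 hK1] := tail 1 ltr01.
have sub : has_ubound (range s).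
  exists (s K1 + 1) => _ [n _ <-]; have [nK|Kn] := leqP n K1.
    by rewrite (le_trans (snd _ _ nK))// lerDl.
  by rewrite /s (big_cat_nat (leq0n K1) (ltnW Kn))/= lerD2l; exact: tailG.
have scv := nondecreasing_is_cvgn snd sub.
exists (limn s); split; last first.
  apply: cvg_lim => //; rewrite (_ : (fun n => _) = EFin \o s).
    by apply: cvg_EFin => //; exact: nearW.
  by apply/funext => n; rewrite /= /s sumEFin.
apply/cvgrPdist_le => e e0; have e30 : 0 < e / 3 by rewrite divr_gt0.
have [K hK] := tail _ e30.
have sK : `|limn s - s K| <= e / 3.
  have h1 : s K <= limn s.
    by apply: (cvgr_to_ge scv); exists K => // n /= /snd.
  have h2 : limn s <= s K + e / 3.
    apply: (cvgr_to_le scv); exists K => // n /= Kn.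
    by rewrite /s (big_cat_nat (leq0n K) Kn)/= lerD2l; exact: tailG.
  by rewrite ger0_norm; lra.
near=> n.
have Kr : (K <= r n)%N by near: n; move/cvgnyPge : hr; exact.
have h1 : `|s K - \sum_(0 <= k < K) g n k| <= e / 3.
  by near: n; exact: (cvgr_dist_le _ _ (sumG 0 K) _ e30).
have h2 : \sum_(K <= k < r n) g n k <= e / 3 by near: n.
have h3 : 0 <= \sum_(K <= k < r n) g n k by apply: sumr_ge0.
rewrite (big_cat_nat (leq0n K) Kr)/=.
move: sK h1; rewrite !ler_norml => /andP[? ?] /andP[? ?]; apply/andP; split; lra.
Unshelve. all: by end_near. Qed.

End tail_series.

Section conditioned_law_integral.
Context {R : realType} {d : nat} (N : 'rV[R]_d -> R) (hN : is_norm N).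
Notation path := (pathspace R d).
Context {dY : measure_display} {OmegaY : measurableType dY}
  {Q : probability OmegaY R} (Y : {RV Q >-> path}).
Context {dZ : measure_display} {OmegaZ : measurableType dZ}
  {Q' : probability OmegaZ R} (Z : {RV Q' >-> path}) (hZ : conditioned_law N Y Z).

Lemma no_past_exceedanceE :
  no_past_exceedance N Y = [set o | forall j : int, j < 0 -> N (Y o j) <= 1].
Proof.
apply/seteqP; split=> o.
  by move=> /star_le h j j0; apply: h => /=; lia.
by move=> h; apply/star_le => j /= j1; apply: h; lia.
Qed.

Lemma measurable_no_past_exceedance : measurable (no_past_exceedance N Y).
Proof.
rewrite no_past_exceedanceE -[X in measurable X]setTI.
exact: (@measurable_funPT _ _ _ _ Y) _ _ (measurable_no_past hN).
Qed.

(* [Z] has total mass 1, whereas the conditioned law is null when theta = 0. *)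
Lemma candidate_extremal_index_gt0 : 0 < candidate_extremal_index N Y.
Proof.
rewrite lt_neqAle prob_ge0 andbT; apply/eqP => h.
have := hZ measurableT; rewrite -h invr0 mulr0 /prob.
rewrite (_ : mkset _ = setT); last by apply/seteqP; split.
by rewrite probability_setT/= => /eqP; rewrite oner_eq0.
Qed.

Lemma integral_conditioned_law (g : path -> \bar R) :
  measurable_fun setT g -> (forall x, (0 <= g x)%E) ->
  ((candidate_extremal_index N Y)%:E * \int[Q']_o g (Z o) =
   \int[Q]_(o in no_past_exceedance N Y) g (Y o))%E.
Proof.
move=> mg g0; set theta := candidate_extremal_index N Y.
have t0 : 0 < theta := candidate_extremal_index_gt0.
have mZ : measurable_fun setT Z by exact: measurable_funPT.
have mY : measurable_fun setT Y by exact: measurable_funPT.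
have mE := measurable_no_past_exceedance.
have mgY : measurable_fun setT (g \o Y) by exact: measurableT_comp.
pose t : {nonneg R} := NngNum (ltW t0).
transitivity (\int[mscale t Q']_o g (Z o))%E.
  by rewrite ge0_integral_mscale//; exact: measurableT_comp.
transitivity (\int[mrestr Q mE]_o g (Y o))%E.
  apply: ge0_integral_eq_law => // A mA.
  have mZA : measurable (Z @^-1` A) by rewrite -[X in measurable X]setTI; exact: mZ.
  have mYA : measurable (Y @^-1` A) by rewrite -[X in measurable X]setTI; exact: mY.
  rewrite /mscale/= /mrestr; have := hZ mA; rewrite /prob => h.
  transitivity (theta%:E * (fine (Q' (Z @^-1` A)))%:E)%E.
    by congr (_ * _)%E; rewrite fineK// fin_num_measure.
  rewrite [fine _]h -EFinM.
  rewrite [X in X%:E]mulrC divfK ?gt_eqF// fineK// fin_num_measure//.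
  exact: measurableI.
rewrite (@ge0_negligible_integral _ _ _ _ _ (~` no_past_exceedance N Y))//; last 2 first.
- exact: measurableC.
- rewrite -[LHS]/(Q (~` no_past_exceedance N Y `&` no_past_exceedance N Y)).
  by rewrite setICl measure0.
rewrite setTD setCK; apply: eq_measure_integral => A mA AE.
by rewrite -[LHS]/(Q (A `&` no_past_exceedance N Y)) setIidl.
Qed.

End conditioned_law_integral.

Section two_blocks.
Context {R : realType} {d : nat} (N : 'rV[R]_d -> R) (hN : is_norm N).
Notation path := (pathspace R d).
Context {dX : measure_display} {Omega : measurableType dX}
  {P : probability Omega R} (X : {RV P >-> path}).
Context {dY : measure_display} {OmegaY : measurableType dY}
  {Q : probability OmegaY R} (Y : {RV Q >-> path}).
Context (hX : stationary X) (H : path -> R) (hH : cluster_functional N Y H).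
Context (M : R) (M0 : 0 <= M) (HM : forall x, ell0 N x -> H x <= M).

Lemma shift_restrict_path s a b (x : path) :
  shift_path s (restrict_path (int_segment a b) x) =
  restrict_path (int_segment (a - s) (b - s)) (shift_path s x).
Proof.
apply/funext => j; rewrite /shift_path /restrict_path /patch.
rewrite (_ : (j + s \in int_segment a b) = (j \in int_segment (a - s) (b - s)))//.
by apply/idP/idP; rewrite !inE /int_segment/=; lia.
Qed.

Lemma expectation_two_blocks (u : R) (r : nat) : 0 < u ->
  ('E_P[fun o => (H (scale_path u^-1 (restrict_path (int_segment 1 (2 * r)%N%:Z) (X o)))
          * \1_(block_event N X r u 1 `&` block_event N X r u 2) o)%R])%E =
  (\sum_(0 <= k < r) \int[P]_o anchored_fun N H k (restrict_path
     (int_segment (1 - r%:Z + k%:Z) (r%:Z + k%:Z)) (scale_path u^-1 (X o))))%:E.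
Proof.
move=> u0.
have nrm (x : path) j : (1 < N (scale_path u^-1 x j)) = (u < N (x j)).
  by rewrite /scale_path (norm_scale hN) gtr0_norm ?invr_gt0// ltr_pdivlMl// mulr1.
pose Psi k (x : path) := anchored_fun N H k (restrict_path
     (int_segment (1 - r%:Z + k%:Z) (r%:Z + k%:Z)) (scale_path u^-1 x)).
have mPsi k : measurable_fun setT (Psi k).
  apply: (measurableT_comp (measurable_anchored_fun hN hH k)).
  exact: (measurableT_comp (@measurable_restrict_path _ _ _) (@measurable_scale_path _ _ _)).
have Psi0 k x : 0 <= Psi k x by exact: anchored_fun_ge0 hH _ _.
have mX : measurable_fun setT X by exact: measurable_funPT.
have pointwise o : H (scale_path u^-1 (restrict_path (int_segment 1 (2 * r)%N%:Z) (X o)))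
    * \1_(block_event N X r u 1 `&` block_event N X r u 2) o =
    \sum_(0 <= k < r) Psi k (shift_path (r%:Z - k%:Z) (X o)).
  set x := scale_path _ _.
  have xE : x = restrict_path (int_segment 1 (2 * r)%N%:Z) (scale_path u^-1 (X o)).
    exact: restrict_scale_path.
  have xj j : int_segment 1 (2 * r)%N%:Z j -> (1 < N (x j)) = (u < N (X o j)).
    by move=> hj; rewrite xE /restrict_path patchT ?inE// nrm.
  transitivity (\sum_(0 <= k < r) anchored_fun N H k (shift_path (r%:Z - k%:Z) x)); last first.
    apply: eq_bigr => k _; rewrite xE shift_restrict_path /Psi.
    congr anchored_fun; congr restrict_path; congr int_segment; lia.
  rewrite (first_exceedance_decomposition hH); last 2 first.
  - by rewrite xE; exact: ell0_restrict_segment.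
  - by rewrite xE; exact: exceedances_in_restrict.
  congr (_ * _); rewrite !indicE; congr (nat_of_bool _)%:R.
  apply/idP/idP; rewrite !inE /block_event/= mul0n mul1n.
    move=> [/star_gt[j1 h1 h1'] /star_gt[j2 h2 h2']]; split.
      by exists j1 => //; rewrite xj//; move: h1; rewrite /int_segment/=; lia.
    by exists j2 => //; rewrite xj//; move: h2; rewrite /int_segment/=; lia.
  move=> [[j1 h1 h1'] [j2 h2 h2']]; split; apply/star_gt.
    by exists j1 => //; rewrite -xj//; move: h1; rewrite /int_segment/=; lia.
  by exists j2 => //; rewrite -xj//; move: h2; rewrite /int_segment/=; lia.
rewrite unlock.
transitivity (\int[P]_o (\sum_(k <- index_iota 0 r) (Psi k (shift_path (r%:Z - k%:Z) (X o)))%:E)%R)%E.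
  by apply: eq_integral => o _; rewrite pointwise sumEFin.
have mS k : measurable_fun setT (fun o => shift_path (r%:Z - k%:Z) (X o)).
  exact: (measurableT_comp (@measurable_shift_path _ _ _) mX).
rewrite ge0_integral_sum//; last first.
- by move=> k o _; rewrite lee_fin.
- move=> k; apply/measurable_EFinP; exact: (measurableT_comp (mPsi k) (mS k)).
rewrite -sumEFin; apply: eq_bigr => k _.
transitivity (\int[P]_o (Psi k (X o))%:E)%E.
  apply: (@ge0_integral_eq_law _ _ _ _ _ _ _ P P _ X (EFin \o Psi k)) => //.
  - by move=> A mA; exact: hX.
  - by apply/measurable_EFinP.
  - by move=> x; rewrite lee_fin.
rewrite /Rintegral fineK//; apply: integrable_fin_num => //.
apply: (@bounded_integrable _ _ _ _ _ M); first exact: (measurableT_comp (mPsi k) mX).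
by move=> o; exact: (anchored_fun_bounded hH M0 HM).
Qed.

End two_blocks.

Section limit_identification.
Context {R : realType} {d : nat} (N : 'rV[R]_d -> R) (hN : is_norm N).
Notation path := (pathspace R d).
Context {dY : measure_display} {OmegaY : measurableType dY}
  {Q : probability OmegaY R} (Y : {RV Q >-> path}).
Context {dZ : measure_display} {OmegaZ : measurableType dZ}
  {Q' : probability OmegaZ R} (Z : {RV Q' >-> path}) (hZ : conditioned_law N Y Z).
Context (H : path -> R) (hH : cluster_functional N Y H).
Context (M : R) (M0 : 0 <= M) (HM : forall x, ell0 N x -> H x <= M).
Context (Y0 : prob (P := Q) [set o | N (Y o 0) <= 1] = 0).

Lemma integral_cluster_length :
  ((candidate_extremal_index N Y)%:E * \int[Q']_(o in [set o | ell0 N (Z o)])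
          ((cluster_length N (Z o) - 1) * H (Z o))%R%:E)%E =
  (\sum_(0 <= k <oo) (\int[Q]_o anchored_fun N H k (Y o))%:E)%E.
Proof.
have mZ : measurable_fun setT Z by exact: measurable_funPT.
have mY : measurable_fun setT Y by exact: measurable_funPT.
have mD : measurable [set o | ell0 N (Z o)].
  by rewrite -[X in measurable X]setTI; exact: mZ (measurable_ell0 hN).
have mS k : measurable_fun setT (fun o => (spread_fun N H k (Z o))%:E).
  by apply/measurable_EFinP; exact: (measurableT_comp (measurable_spread_fun hN hH k) mZ).
have S0 k x : (0 <= (spread_fun N H k x)%:E)%E by rewrite lee_fin (spread_fun_ge0 hH).
transitivity ((candidate_extremal_index N Y)%:E * \sum_(0 <= k <oo)
    \int[Q']_o (spread_fun N H k (Z o))%:E)%E.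
  congr (_ * _)%E.
  transitivity (\int[Q']_(o in [set o | ell0 N (Z o)])
      \sum_(0 <= k <oo) (spread_fun N H k (Z o))%:E)%E.
    by apply: eq_integral => o; rewrite inE => ho; rewrite (spread_fun_series hH).
  rewrite integral_nneseries//; last by move=> k; exact: measurable_funTS.
  apply: eq_eseriesr => k _; rewrite integral_mkcond; apply: eq_integral => o _.
  rewrite /patch; case: ifPn => // ho; congr EFin; rewrite /spread_fun /patch ifF//.
  by apply: contraNF ho; rewrite !inE => -[].
rewrite -nneseriesZl; last by move=> k _; exact: integral_ge0.
apply: eq_eseriesr => k _.
rewrite (integral_conditioned_law hN hZ (g := fun x => (spread_fun N H k x)%:E))//; last first.
  by apply/measurable_EFinP; exact: (measurable_spread_fun hN hH k).
have mA : measurable_fun setT (fun o => (anchored_fun N H k (Y o))%:E).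
  by apply/measurable_EFinP; exact: (measurableT_comp (measurable_anchored_fun hN hH k) mY).
rewrite /Rintegral fineK; last first.
  apply: integrable_fin_num => //; apply: (@bounded_integrable _ _ _ _ _ M).
    exact/measurable_EFinP.
  by move=> o; exact: (anchored_fun_bounded hH M0 HM).
have mE := measurable_no_past_exceedance hN Y.
rewrite [LHS]integral_mkcond; apply: ge0_ae_eq_integral => //.
- apply/(measurable_restrictT _ mE); apply: measurable_funTS; apply/measurable_EFinP.
  exact: (measurableT_comp (measurable_spread_fun hN hH k) mY).
- by move=> o _; rewrite /patch; case: ifP.
- by move=> o _; rewrite lee_fin (anchored_fun_ge0 hH).
have mY0 : measurable [set o | N (Y o 0) <= 1].
  by rewrite -[X in measurable X]setTI; exact: mY (measurable_norm_le hN 0 1).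
exists [set o | N (Y o 0) <= 1]; split => //.
  by apply/eqP; rewrite -fine_eq0 ?fin_num_measure//; apply/eqP.
move=> o /= ho; rewrite leNgt; apply/negP => h0; apply: ho => _.
rewrite /patch /anchored_fun /spread_fun /patch.
have anE : anchored N (Y o) <-> no_past_exceedance N Y o.
  by rewrite no_past_exceedanceE /anchored/=; split => [[]|].
have [ho|ho] := boolP (o \in _).
  congr EFin; congr (if _ then _ else _); apply/idP/idP; rewrite !inE.
    by move=> h; split => //; apply/anE; move: ho; rewrite inE.
  by move=> [].
rewrite ifF//; apply/negbTE/negP; rewrite inE => -[_ /anE h].
by move: ho; rewrite mem_set.
Qed.

End limit_identification.

Theorem proposition5p3p1
  (R : realType) (d : nat) (hd : (1 <= d)%N)
  (N : 'rV[R]_d -> R) (hN : is_norm N)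
  (dX : measure_display) (Omega : measurableType dX)
  (P : probability Omega R) (X : {RV P >-> pathspace R d})
  (dY : measure_display) (OmegaY : measurableType dY)
  (Q : probability OmegaY R) (Y : {RV Q >-> pathspace R d})
  (dZ : measure_display) (OmegaZ : measurableType dZ)
  (Q' : probability OmegaZ R) (Z : {RV Q' >-> pathspace R d})
  (alpha : R) (halpha : 0 < alpha)
  (hX : stationary X) (hindex : tail_index N X alpha)
  (hY : tail_process N X Y) (hZ : conditioned_law N Y Z)
  (u : nat -> R) (r : nat -> nat) (w : nat -> R)
  (hw : forall n, w n = prob (P := P) (exceedance N X (u n)))
  (hu0 : forall n, 0 < u n)
  (hu : u n @[n --> \oo] --> +oo)
  (hr : r n @[n --> \oo] --> \oo)
  (hnw : n%:R * w n @[n --> \oo] --> +oo)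
  (hrn : (r n)%:R / n%:R @[n --> \oo] --> (0 : R))
  (hrw : (r n)%:R * w n @[n --> \oo] --> (0 : R))
  (hS : condition_S N X 1 r u)
  (H : pathspace R d -> R) (hH : cluster_functional N Y H)
  (hHb : exists M : R, forall x, ell0 N x -> H x <= M) :
  ('E_P[fun o => (H (scale_path (u n)^-1
            (restrict_path (int_segment 1 (2 * r n)%N%:Z) (X o)))
          * \1_(block_event N X (r n) (u n) 1
                `&` block_event N X (r n) (u n) 2) o)%R]
     / (w n)%:E)%E @[n --> \oo]
  --> ((candidate_extremal_index N Y)%:E *
       \int[Q']_(o in [set o | ell0 N (Z o)])
          ((cluster_length N (Z o) - 1) * H (Z o))%R%:E)%E.
Proof.
have [M1 hM1] := hHb; pose M := Num.max M1 0.
have M0 : 0 <= M by rewrite le_max lexx orbT.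
have HM x : ell0 N x -> H x <= M by move=> /hM1 h; rewrite le_max h.
have w0 : \forall n \near \oo, 0 < w n.
  move/cvgryPgt/(_ 0) : hnw; apply: filterS => n hn.
  rewrite lt_neqAle hw prob_ge0 andbT -hw; apply/eqP => h.
  by move: hn; rewrite -h mulr0 ltxx.
have [hS1 /(_ 2 ltac:(by rewrite ltr1n))] := hS.
rewrite (_ : (fun n => Num.truncn (2 * (r n)%:R)) = (fun n => (2 * r n)%N)); last first.
  by apply/funext => n; rewrite -natrM natrK.
move=> hS2.
pose a n (k : nat) : int := 1 - (r n)%:Z + k%:Z.
pose b n (k : nat) : int := (r n)%:Z + k%:Z.
pose g n k := (w n)^-1 * anchored_mean N X u H n k (a n k) (b n k).
have rlarge (p : nat) : \forall n \near \oo, (p <= r n)%N by move/cvgnyPge : hr; exact.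
have g0 n k : 0 <= g n k.
  apply: mulr_ge0; first by rewrite invr_ge0 hw prob_ge0.
  by apply: Rintegral_ge0 => o _; exact: (anchored_fun_ge0 hH).
have gG k : g n k @[n --> \oo] --> \int[Q]_o anchored_fun N H k (Y o).
  apply: (anchored_fun_limit hN hX hindex hY hw hu0 hu hr hS1 hS2 hH M0 HM).
    by have := rlarge k; apply: filterS => n; rewrite /a /b; lia.
  move=> m; have := rlarge (m + k + 1)%N; apply: filterS => n; rewrite /a /b; lia.
have tail e : 0 < e -> exists K, \forall n \near \oo, \sum_(K <= k < r n) g n k <= e.
  move=> e0; have [K hK] := anchored_fun_tail hN hw hu0 hS2 hH M0 HM e0.
  exists K; move: hK; apply: filterS => n; apply => k; rewrite /b; lia.
have [S [cS sS]] := tail_series_cvg g0 gG hr tail.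
have Y0 := tail_process_gt_one hN hindex hY hw hu0 hu w0.
rewrite (integral_cluster_length hN hZ hH M0 HM Y0).
have cE : (\sum_(0 <= k < r n) g n k)%:E @[n --> \oo] --> S%:E.
  by apply: cvg_EFin => //; exact: nearW.
rewrite sS; apply: cvg_trans cE; apply: near_eq_cvg; near=> n.
have wn : 0 < w n by near: n.
rewrite (expectation_two_blocks hN hX hH M0 HM)//.
by rewrite inver gt_eqF// -EFinM mulrC mulr_sumr.
Unshelve. all: by end_near. Qed.
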